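(* The $W$-Brownian motion exists: there is a probability space carrying a real-valued process $(B_W(t))_{t\in[0,1)}$ such that (1) $B_W(0)=0$ almost surely; (2) for $t>s$, $B_W(t)-B_W(s)$ is independent of $\sigma(B_W(u);u\le s)$; (3) for $t>s$, $B_W(t)-B_W(s)$ has $N(0,W(t)-W(s))$ distribution; (4) $B_W$ has càdlàg sample paths.
   Context: $W:\mathbb{R}\to\mathbb{R}$ is strictly increasing and càdlàg (right-continuous with left limits), $W(x+1)-W(x)=W(1)-W(0)$ for all $x$, $W$ is continuous at $0$ and $W(0)=0$. The torus $\mathbb{T}=\mathbb{R}/\mathbb{Z}$ is identified with $[0,1)$, and the process is considered on $[0,1)$. A process satisfying (1)-(4) is called a $W$-Brownian motion. *)

(* Defs.v *)
From HB Require Import structures.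
From mathcomp Require Import all_boot all_order all_algebra.
From mathcomp Require Import all_classical all_reals all_analysis.
From mathcomp Require Import measurable_realfun.

Set Implicit Arguments.
Unset Strict Implicit.
Unset Printing Implicit Defensive.

Import Order.TTheory GRing.Theory Num.Theory.
Import numFieldNormedType.Exports.

Local Open Scope classical_set_scope.
Local Open Scope ring_scope.

(* Both one-sided limits are taken within D, and they are finite since f is
   real-valued. At a point of D that is not a limit point of D from the left
   (such as 0 for D = [0, 1[), the filter [within D t^'-] contains set0 and the
   left-limit condition holds vacuously. *)
Definition cadlag_on (R : realType) (D : set R) (f : R -> R) : Prop :=
  forall t, D t ->
    f x @[x --> within D t^'+] --> f t /\ cvg (f x @[x --> within D t^'-]).

Definition independent_classes (d : measure_display) (T : measurableType d)
    (R : realType) (P : probability T R) (F G : set_system T) : Prop :=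
  forall A B, F A -> G B -> P (A `&` B) = (P A * P B)%E.

Definition sigma_rv (d : measure_display) (T : measurableType d)
    (R : realType) (X : T -> R) : set_system T :=
  preimage_set_system setT X measurable.

(* sigma(X_u ; u in D) *)
Definition sigma_process (d : measure_display) (T : measurableType d)
    (R : realType) (D : set R) (X : R -> T -> R) : set_system T :=
  <<s \bigcup_(u in D) sigma_rv (X u) >>.

(* The time set is [0, 1[: the values of B outside of it are irrelevant. The
   second parameter of [normal_prob] is the standard deviation, hence the square
   root (never 0 for W strictly increasing, where [normal_prob] would not be a
   Dirac mass); the two laws are compared on Borel sets because [normal_prob] and
   [distribution] are functions on arbitrary sets. *)
Record W_Brownian_motion (R : realType) (W : R -> R) (d : measure_display)
    (T : measurableType d) (P : probability T R) (B : R -> {RV P >-> R}) : Prop :=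
  WBrownianMotion {
    wbm_start : {ae P, forall w, B 0 w = 0} ;
    wbm_indep : forall s t : R, 0 <= s -> s < t -> t < 1 ->
      independent_classes P (sigma_rv (B t \- B s))
        (sigma_process `[0, s] (fun u => B u : T -> R)) ;
    wbm_law : forall s t : R, 0 <= s -> s < t -> t < 1 ->
      forall A : set R, measurable A ->
        distribution P (B t \- B s)%R A =
        normal_prob 0 (Num.sqrt (W t - W s)) A ;
    wbm_cadlag : forall w, cadlag_on `[0, 1[ (fun t => B t w)
  }.

(* Main.v *)
Require Import Defs.
From HB Require Import structures.
From mathcomp Require Import all_boot all_order all_algebra.
From mathcomp Require Import all_classical all_reals all_analysis.
From mathcomp Require Import measurable_realfun.
From mathcomp Require Import ring lra.
Import Order.TTheory GRing.Theory Num.Theory.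
Import numFieldNormedType.Exports.
Local Open Scope classical_set_scope.
Local Open Scope ring_scope.

Set Implicit Arguments.
Unset Strict Implicit.
Unset Printing Implicit Defensive.

(* The process is B (W t / W 1), suitably rescaled, for a Brownian motion B on
   [0, 1] in the manner of Levy: since B has continuous paths and W is cadlag
   and increasing, the composite is cadlag, and its increments inherit
   independence and Gaussian laws from those of B. An infinite family of
   independent Gaussians is avoided by self-similarity. A state is a pair (x, w)
   where x is Gaussian and w is uniform on [0, 1]; splitting the binary digits of
   w produces a fresh Gaussian z and two independent uniform variables, and by
   rotation invariance (x + z) / sqrt 2 and (x - z) / sqrt 2 start two
   independent copies of the state. Iterating this branching n times yields the
   2 ^ n increments of B over the dyadic intervals of length 2 ^ - n. A fourth
   moment bound and the Borel-Cantelli lemma make the dyadic walks converge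
   uniformly, and the joint laws pass to the limit against continuous test
   functions, hence to rays, which generate all the sigma-algebras involved. *)

(** The maps [gb_left] and [gb_right] jointly carry [P] to the product of [P] with itself, so each
    generation doubles the number of independent copies by mere induction. Every copy is again
    standard Gaussian: this is why increments of generation [n] are divided by [sqrt 2 ^ n] and why
    [gb_split] has a factor [sqrt 2]. That relation makes the levels consistent: refining the mesh
    leaves the walk unchanged at the old nodes.

    Independence of the two digit streams is read off a functional equation for the tails of their
    joint law, because dropping one binary digit exchanges the streams.

    Uniform convergence requires control of [2 ^ n] Gaussians at once. A second moment bound merely
    offsets this number and leaves [r ^ (- 2 n)], which is not summable; the fourth moment gains a
    further factor [2 ^ (- n)]. Convergence is obtained almost everywhere while every path must be
    càdlàg, so paths are set to zero on the null event. *)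

(** * Affine change of variables and rotation invariance of the Gaussian measure *)

Section affine.
Context {R : realType}.
Local Notation mu := (@lebesgue_measure R).

(** Both sides are measures in [A], so half-open intervals decide. A negative slope moves the closed
    end to the other side, which does not affect the length. *)
Lemma lebesgue_measure_affine (a b : R) (A : set R) : a != 0 -> measurable A ->
  mu A = (`|a|%:E * mu ((fun x => (a * x + b)%R) @^-1` A))%E.
Proof.
move=> a0 mA.
have mf : measurable_fun [set: measurableTypeR R] (fun x : measurableTypeR R => (a * x + b)%R : measurableTypeR R).
  by apply: measurable_funD => //; apply: measurable_funM.
pose m : {measure set (measurableTypeR R) -> \bar R} :=
  mscale (NngNum (normr_ge0 a)) (pushforward mu (fun x : measurableTypeR R => (a * x + b)%R : measurableTypeR R)).
suff : mu A = m mf A by [].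
apply: lebesgue_measure_unique => // _ [[u v] _ <-] /=.
rewrite /m /mscale/= /pushforward.
have [a_gt0|] := ltP 0 a; last rewrite le_eqVlt (negbTE a0)/= => a_lt0.
  have -> : (fun x => (a * x + b)%R) @^-1` `]u, v] = `](u - b) / a, (v - b) / a]%classic.
    apply/seteqP; split => x /=; rewrite !in_itv/=.
      by move=> /andP[h1 h2]; rewrite ltr_pdivrMr// ler_pdivlMr//; lra.
    by rewrite ltr_pdivrMr// ler_pdivlMr// => /andP[h1 h2]; lra.
  rewrite !lebesgue_measure_itv/= !lte_fin ltr_pM2r ?invr_gt0// ltrD2r.
  case: ifPn => _; last by rewrite mule0.
  by rewrite gtr0_norm// -!EFinB -EFinM; congr EFin; field.
have -> : (fun x => (a * x + b)%R) @^-1` `]u, v] = `[(v - b) / a, (u - b) / a[%classic.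
  apply/seteqP; split => x /=; rewrite !in_itv/=.
    by move=> /andP[h1 h2]; rewrite ler_ndivrMr// ltr_ndivlMr//; lra.
  by rewrite ler_ndivrMr// ltr_ndivlMr// => /andP[h1 h2]; lra.
rewrite !lebesgue_measure_itv/= !lte_fin ltr_nM2r ?invr_lt0// ltrD2r.
case: ifPn => _; last by rewrite mule0.
by rewrite ltr0_norm// -!EFinB -EFinM; congr EFin; field.
Qed.

Lemma ge0_integral_affine (a b : R) (f : R -> \bar R) : a != 0 ->
  measurable_fun setT f -> (forall x, 0 <= f x)%E ->
  (\int[mu]_x f x = `|a|%:E * \int[mu]_x f (a * x + b)%R)%E.
Proof.
move=> a0 mf f0.
have mg : measurable_fun [set: measurableTypeR R] (fun x : measurableTypeR R => (a * x + b)%R : measurableTypeR R).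
  by apply: measurable_funD => //; apply: measurable_funM.
have := @ge0_integral_pushforward _ _ _ _ _ _ mg mu setT f measurableT mf (fun x _ => f0 x).
rewrite preimage_setT => <-.
rewrite -(@ge0_integral_mscale _ _ _ _ _ measurableT (NngNum (normr_ge0 a)))//.
by apply: eq_measure_integral => A mA _; exact: lebesgue_measure_affine.
Qed.

End affine.

Section gaussian_rotation.
Context {R : realType}.
Local Notation mu := (@lebesgue_measure R).
Local Notation RT := (measurableTypeR R).
Local Notation N01 := (@normal_prob R 0 1).

(** The Radon-Nikodym derivative agrees almost everywhere with the density, since both have the same
    integral over every measurable set. *)
Lemma integral_normal_prob (m s : R) (f : R -> \bar R) :
  (normal_prob m s).-integrable setT f ->
  (\int[normal_prob m s]_x f x = \int[mu]_x (f x * (normal_pdf m s x)%:E))%E.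
Proof.
move=> intf; have mf := measurable_int _ intf.
rewrite -(Radon_Nikodym_change_of_variables (normal_prob_dominates m s))//=.
apply: ae_eq_integral => //.
- apply: emeasurable_funM => //; apply: (measurable_int mu).
  by apply: Radon_Nikodym_integrable; exact: normal_prob_dominates.
- apply: emeasurable_funM => //=; apply/measurableT_comp => //=.
  exact: measurable_normal_pdf.
- apply: ae_eqe_mul2l => /=.
  rewrite Radon_NikodymE//=; first exact: normal_prob_dominates.
  move=> abmu.
  case: cid => /= h [h1 h2 h3].
  apply: integral_ae_eq => //=.
  + by apply/measurableT_comp =>//; exact: measurable_normal_pdf.
  + by move=> E E01 mE; rewrite -h3.
Qed.

Lemma integrable_unit_interval d (T : measurableType d) (P : probability T R) (f : T -> R) :
  measurable_fun setT f -> (forall x, 0 <= f x <= 1) ->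
  P.-integrable setT (EFin \o f).
Proof.
move=> mf f01; apply: (@le_integrable _ _ _ _ _ _ _ (cst 1%E)) => //.
- exact/measurable_EFinP.
- move=> x _ /=; have /andP[f0 f1] := f01 x.
  by rewrite lee_fin ger0_norm// ?normr1.
- exact: finite_measure_integrable_cst.
Qed.

(** The map is a reflection of the plane, so it preserves the sum of squares in the exponent. *)
Lemma normal_pdf_rotation (a b u v : R) : a ^+ 2 + b ^+ 2 = 1 ->
  normal_pdf 0 1 (a * u + b * v) * normal_pdf 0 1 (b * u - a * v) =
  normal_pdf 0 1 u * normal_pdf 0 1 v.
Proof.
move=> ab1; rewrite /normal_pdf oner_eq0 /normal_fun /=.
rewrite mulrACA -expRD [RHS]mulrACA -expRD; congr (_ * expR _).
suff : (a * u + b * v) ^+ 2 + (b * u - a * v) ^+ 2 = (a ^+ 2 + b ^+ 2) * (u ^+ 2 + v ^+ 2).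
  by rewrite ab1 mul1r !subr0 => ?; lra.
ring.
Qed.


Lemma measurable_fun_pair1 d1 d2 d3 (T1 : measurableType d1) (T2 : measurableType d2)
  (T3 : measurableType d3) (f : T1 * T2 -> T3) x :
  measurable_fun setT f -> measurable_fun setT (fun y => f (x, y)).
Proof. by move=> mf; apply: measurableT_comp => //; exact: measurable_pair1. Qed.

(** Moves the double integral to Lebesgue measure, where affine substitutions can be made in one
    coordinate at a time. *)
Lemma integral_normal_normal (G : RT * RT -> R) :
  measurable_fun setT G -> (forall z, 0 <= G z <= 1) ->
  (\int[N01]_x \int[N01]_y (G (x, y))%:E =
   \int[mu]_x \int[mu]_y (G (x, y) * normal_pdf 0 1 x * normal_pdf 0 1 y)%:E)%E.
Proof.
move=> mG G01.
have mG1 x : measurable_fun setT (fun y => G (x, y)).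
  exact: (@measurable_fun_pair1 _ _ _ RT RT R).
have iG x : (\int[N01]_y (G (x, y))%:E)%E \is a fin_num.
  apply: integrable_fin_num => //.
  exact: (@integrable_unit_interval _ _ N01 (fun y => G (x, y)) (mG1 x) (fun y => G01 (x, y))).
have mI : measurable_fun setT (fun x => \int[N01]_y (G (x, y))%:E)%E.
  apply: (@measurable_fun_fubini_tonelli_F _ _ RT RT R N01 (EFin \o G)).
  - exact/measurable_EFinP.
  - by move=> z /=; rewrite lee_fin; case/andP: (G01 z).
rewrite integral_normal_prob; last first.
  rewrite (_ : (fun x => _) = EFin \o (fun x => fine (\int[N01]_y (G (x, y))%:E)%E)); last first.
    by apply/funext => x /=; rewrite fineK.
  apply: integrable_unit_interval.
    exact: measurableT_comp.
  move=> x; rewrite fine_ge0/=; last first.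
    by apply: integral_ge0 => y _; rewrite lee_fin; case/andP: (G01 (x, y)).
  rewrite -lee_fin fineK//.
  rewrite [leRHS](_ : _ = \int[N01]_y (cst 1%E y))%E; last first.
    by rewrite integral_cst//= probability_setT mule1.
  apply: ge0_le_integral => //.
  - by move=> y _; rewrite lee_fin; case/andP: (G01 (x, y)).
  - exact/measurable_EFinP.
  - by move=> y _; rewrite lee_fin; case/andP: (G01 (x, y)).
apply: eq_integral => x _.
rewrite integral_normal_prob; last first.
  exact: (@integrable_unit_interval _ _ N01 (fun y => G (x, y)) (mG1 x) (fun y => G01 (x, y))).
rewrite [RHS](_ : _ = \int[mu]_y ((G (x, y) * normal_pdf 0 1 y)%:E * (normal_pdf 0 1 x)%:E))%E; last first.
  by apply: eq_integral => y _; rewrite -!EFinM mulrAC.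
rewrite ge0_integralZr//.
- apply/measurable_EFinP; apply: measurable_funM => //.
  exact: measurable_normal_pdf.
- by move=> y _; rewrite lee_fin mulr_ge0 ?normal_pdf_ge0//; case/andP: (G01 (x, y)).
- by rewrite lee_fin normal_pdf_ge0.
Qed.

(** The planar substitution splits into two linear ones. For fixed [y], set [u = a * x + b * y];
    then, for fixed [u], set [v = (b * u - y) / a]. The Jacobians cancel and [normal_pdf_rotation]
    restores the density. *)
Lemma gaussian_rotation (a b : R) (F : RT * RT -> R) : a ^+ 2 + b ^+ 2 = 1 -> a != 0 ->
  measurable_fun setT F -> (forall z, 0 <= F z <= 1) ->
  (\int[N01]_x \int[N01]_y (F (a * x + b * y, b * x - a * y)%R)%:E =
   \int[N01]_x \int[N01]_y (F (x, y))%:E)%E.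
Proof.
move=> ab1 a0 mF F01.
have F0 z : 0 <= F z by case/andP: (F01 z).
pose p := @normal_pdf R 0 1.
have mp : measurable_fun setT p by exact: measurable_normal_pdf.
have p0 x : 0 <= p x by exact: normal_pdf_ge0.
(* The integrand in the variables [(u, y)], between the two substitutions. *)
pose K (z : RT * RT) := F (z.1, (b * z.1 - z.2) / a) * p ((z.1 - b * z.2) / a) * p z.2.
have mlin (c c' : R) : measurable_fun setT (fun z : RT * RT => c * z.1 + c' * z.2).
  by apply: measurable_funD; apply: measurable_funM.
have mlin' (c c' : R) : measurable_fun setT (fun z : RT * RT => c * z.1 - c' * z.2).
  by apply: measurable_funB; apply: measurable_funM.
have mK : measurable_fun setT K.
  apply: measurable_funM; [apply: measurable_funM|].
  - apply: measurableT_comp => //; apply: measurable_fun_pair => //=.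
    apply: (@measurable_funM _ _ R) => //; apply: measurable_funB => //.
    exact: measurable_funM.
  - apply: measurableT_comp => //.
    apply: (@measurable_funM _ _ R) => //; apply: measurable_funB => //.
    exact: measurable_funM.
  - exact: measurableT_comp.
have K0 z : (0 <= (K z)%:E)%E by rewrite lee_fin !mulr_ge0.
refine (etrans _ (esym (integral_normal_normal mF F01))).
have mFab : measurable_fun setT
    (fun z : RT * RT => F (a * z.1 + b * z.2, b * z.1 - a * z.2)).
  by apply: measurableT_comp => //; exact: measurable_fun_pair.
refine (etrans (integral_normal_normal mFab (fun=> F01 _)) _).
pose H (z : RT * RT) := F (a * z.1 + b * z.2, b * z.1 - a * z.2) * p z.1 * p z.2.
have mH : measurable_fun setT H.
  apply: measurable_funM; [apply: measurable_funM|]; last 2 first.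
  - exact: measurableT_comp.
  - exact: measurableT_comp.
  by apply: measurableT_comp => //; exact: measurable_fun_pair.
have H0 z : (0 <= (H z)%:E)%E by rewrite lee_fin !mulr_ge0.
transitivity (\int[mu]_y \int[mu]_x (H (x, y))%:E)%E.
  exact: (@fubini_tonelli _ _ RT RT R mu mu (EFin \o H) (measurableT_comp _ mH) H0).
transitivity (`|a^-1|%:E * \int[mu]_y \int[mu]_u (K (u, y))%:E)%E.
  rewrite -ge0_integralZl//; last first.
  - by move=> y _; exact: integral_ge0.
  - exact: (@measurable_fun_fubini_tonelli_G _ _ RT RT R mu (EFin \o K) (measurableT_comp _ mK)).
  apply: eq_integral => y _.
  have mHy : measurable_fun setT (fun x => (H (x, y))%:E).
    apply/measurable_EFinP.
    exact: (measurableT_comp mH (@measurable_pair2 _ _ RT RT y)).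
  have a10 : a^-1 != 0 by rewrite invr_eq0.
  refine (etrans (ge0_integral_affine (- b * y / a) a10 mHy (fun=> H0 _)) _).
  refine (congr1 (mule _) _); apply: eq_integral => u _; refine (congr1 EFin _).
  rewrite /H /K /fst /snd.
  have -> : a * (a^-1 * u + - b * y / a) + b * y = u by field.
  have -> : b * (a^-1 * u + - b * y / a) - a * y = (b * u - (a ^+ 2 + b ^+ 2) * y) / a by field.
  by rewrite ab1 mul1r; congr (_ * p _ * _); field.
transitivity (`|a^-1|%:E * \int[mu]_u \int[mu]_y (K (u, y))%:E)%E.
  refine (congr1 (mule _) _).
  exact: (esym (@fubini_tonelli _ _ RT RT R mu mu (EFin \o K) (measurableT_comp _ mK) K0)).
rewrite -ge0_integralZl//; last first.
- by move=> y _; exact: integral_ge0.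
- exact: (@measurable_fun_fubini_tonelli_F _ _ RT RT R mu (EFin \o K) (measurableT_comp _ mK)).
apply: eq_integral => u _.
have mKu : measurable_fun setT (fun y => (K (u, y))%:E).
  apply/measurable_EFinP.
  exact: (measurableT_comp mK (@measurable_pair1 _ _ RT RT u)).
have aN0 : - a != 0 by rewrite oppr_eq0.
refine (etrans (congr1 (mule _)
  (ge0_integral_affine (b * u) aN0 mKu (fun=> K0 _))) _).
rewrite normrN muleA (_ : `|a^-1|%:E * `|a|%:E = 1)%E ?mul1e; last first.
  by rewrite -EFinM normfV mulVf// normr_eq0.
apply: eq_integral => v _; refine (congr1 EFin _); rewrite /K /fst /snd.
have -> : (b * u - (- a * v + b * u)) / a = v by field.
have -> : (u - b * (- a * v + b * u)) / a = a * u + b * v.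
  by rewrite -{1}[u]mul1r -ab1; field.
have -> : - a * v + b * u = b * u - a * v by ring.
by rewrite -!mulrA; refine (congr1 ( *%R _) _); exact: normal_pdf_rotation.
Qed.

End gaussian_rotation.

(** * Splitting a uniform variable into two independent ones *)

Section ray_unique.
Context {R : realType}.
Local Notation RT := (measurableTypeR R).

(** Open upper rays are stable under intersection, generate the Borel sets and exhaust the line. *)
Lemma measure_unique_ray (P Q : {measure set RT -> \bar R}) :
  (P setT < +oo)%E -> (forall a, P `]a, +oo[%classic = Q `]a, +oo[%classic) ->
  forall A, measurable A -> P A = Q A.
Proof.
move=> Poo PQ A mA.
apply: (@measure_unique _ R RT (@RGenOInfty.G R) (fun k => `](- k%:R), +oo[%classic)) => //.
- exact: RGenOInfty.measurableE.
- move=> _ _ [a ->] [b ->]; exists (Num.max a b).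
  by apply/seteqP; split => x /=; rewrite !in_itv/= !andbT gt_max => /andP.
- by move=> k; exists (- k%:R).
- apply/seteqP; split => // x _; exists (Num.truncn `|x|).+1 => //=.
  rewrite in_itv/= andbT ltrNl (le_lt_trans (ler_norm _))// normrN.
  exact: truncnS_gt.
- by move=> _ [a ->].
- move=> k; apply: le_lt_trans Poo; apply: le_measure; rewrite ?inE//.
Qed.

Lemma joint_law_ray d (T : measurableType d) (P : probability T R)
    (X Y : T -> RT) (Q1 Q2 : probability RT R) :
  measurable_fun setT X -> measurable_fun setT Y ->
  (forall a b, P (X @^-1` `]a, +oo[ `&` Y @^-1` `]b, +oo[) =
    (Q1 `]a, +oo[%classic * Q2 `]b, +oo[%classic)%E) ->
  forall A B, measurable A -> measurable B ->
  P (X @^-1` A `&` Y @^-1` B) = (Q1 A * Q2 B)%E.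
Proof.
move=> mX mY PXY.
have mpre (Z : T -> RT) (C : set RT) : measurable_fun setT Z -> measurable C ->
    measurable (Z @^-1` C).
  by move=> mZ mC; rewrite -[X in measurable X]setTI; exact: mZ.
(* With the other event [D] frozen, both sides are finite measures in [A]. Applied once to each
   variable. *)
have step (Z : T -> RT) (Q : probability RT R) (D : set T) (c : \bar R) :
    measurable_fun setT Z -> measurable D -> (0 <= c)%E -> c \is a fin_num ->
    (forall a, P (Z @^-1` `]a, +oo[ `&` D) = (Q `]a, +oo[%classic * c)%E) ->
    forall A, measurable A -> P (Z @^-1` A `&` D) = (Q A * c)%E.
  move=> mZ mD c0 cfin PZ A mA.
  rewrite muleC -[c]fineK// -[(_ * _)%E]/(mscale (NngNum (fine_ge0 c0)) Q A).
  rewrite -[LHS]/(pushforward (mrestr P mD) Z A).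
  apply: measure_unique_ray => //.
    rewrite /pushforward /mrestr -ge0_fin_numE//; apply: fin_num_measure.
    exact: mpre.
  move=> a; rewrite -[LHS]/(P (Z @^-1` `]a, +oo[ `&` D)) PZ muleC.
  by rewrite -[RHS]/((fine c)%:E * Q `]a, +oo[%classic)%E fineK.
move=> A B mA mB.
apply: (@step) => //; [exact: mpre|exact: fin_num_measure|move=> a].
rewrite setIC muleC; apply: (@step) => //; [exact: mpre|exact: fin_num_measure|].
by move=> b; rewrite setIC muleC.
Qed.

End ray_unique.

Section digit_splitting.
Context {R : realType}.
Local Notation RT := (measurableTypeR R).
Local Notation mu := (@lebesgue_measure R).

(** Kept as a measure on the whole line, so that the digit maps are self-maps of one measurable
    space. *)
Definition unif01 : set RT -> \bar R := mrestr mu (measurable_itv `[(0 : R), 1[).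

HB.instance Definition _ := Measure.on unif01.

Let unif01_setT : unif01 setT = 1%E.
Proof.
by rewrite /unif01 /mrestr setTI lebesgue_measure_itv/= lte01 oppr0 adde0.
Qed.

HB.instance Definition _ := @Measure_isProbability.Build _ _ R unif01 unif01_setT.

(** On [[0, 1[] this deletes the first binary digit, which is [2^-1 <= x]. *)
Definition doubling (x : RT) : RT := if x < 2^-1 then 2 * x else 2 * x - 1.

Lemma measurable_doubling : measurable_fun setT doubling.
Proof.
apply: measurable_fun_ifT.
- exact: measurable_fun_ltr.
- exact: (@measurable_funM _ _ R).
- by apply: (@measurable_funB _ _ R) => //; exact: (@measurable_funM _ _ R).
Qed.

Let unif01_branch (c : R) (A : set RT) : measurable A ->
  unif01 A = (2%:E * mu ((fun x : R => 2 * x - c)%R @^-1` (A `&` `[0%R, 1%R[)))%E.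
Proof.
move=> mA; rewrite /unif01 /mrestr (@lebesgue_measure_affine _ 2 (- c))//.
  by rewrite normr_nat.
exact: measurableI.
Qed.

(** Conditionally on the first digit, the remaining digits are again uniform; [E0] and [E1] are what
    the event becomes for the digits 0 and 1. *)
Lemma unif01_doubling (E E0 E1 : set RT) :
  measurable E -> measurable E0 -> measurable E1 ->
  (forall x, x < 2^-1 -> E x <-> E0 (doubling x)) ->
  (forall x, 2^-1 <= x -> E x <-> E1 (doubling x)) ->
  fine (unif01 E) = (fine (unif01 E0) + fine (unif01 E1)) / 2.
Proof.
move=> mE mE0 mE1 EE0 EE1.
pose L := (fun x : R => 2 * x - 0)%R @^-1` (E0 `&` `[0, 1[).
pose L' := (fun x : R => 2 * x - 1)%R @^-1` (E1 `&` `[0, 1[).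
have mlin (c : R) : measurable_fun [set: RT] (fun x : RT => (2 * x - c)%R : RT).
  by apply: (@measurable_funB _ _ R) => //; exact: (@measurable_funM _ _ R).
have mL : measurable (L : set RT).
  by rewrite -[L]setTI; apply: mlin => //; exact: measurableI.
have mL' : measurable (L' : set RT).
  by rewrite -[L']setTI; apply: mlin => //; exact: measurableI.
have EL : unif01 E = (mu L + mu L')%E.
  rewrite -measureU//; last first.
    apply/seteqP; split => // x [[_ +] [_ +]].
    rewrite /mkset !in_itv/= => /andP[? ?] /andP[? ?]; lra.
  rewrite /unif01 /mrestr; congr (mu _); apply/seteqP; split => x /=.
    rewrite !in_itv/= => -[Ex /andP[x0 x1]].
    have [xh|xh] := ltP x 2^-1.
      left; split; last by rewrite /= in_itv/=; lra.
      by have /(EE0 _ xh) := Ex; rewrite /doubling xh subr0.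
    right; split; last by rewrite /= in_itv/=; lra.
    by have /(EE1 _ xh) := Ex; rewrite /doubling ltNge xh.
  rewrite /L /L' /=; case=> -[]; rewrite !in_itv/= => H /andP[h1 h2].
    have xh : x < 2^-1 by lra.
    split; last by lra.
    by apply/(EE0 _ xh); rewrite /doubling xh -[2 * x]subr0.
  have xh : 2^-1 <= x by lra.
  split; last by lra.
  by apply/(EE1 _ xh); rewrite /doubling ltNge xh.
have E0L := unif01_branch 0 mE0; have E1L := unif01_branch 1 mE1.
have finL : mu L \is a fin_num.
  rewrite ge0_fin_numE//; apply: le_lt_trans (_ : unif01 E < +oo)%E.
    by rewrite EL leeDl.
  by rewrite -ge0_fin_numE// fin_num_measure.
have finL' : mu L' \is a fin_num.
  rewrite ge0_fin_numE//; apply: le_lt_trans (_ : unif01 E < +oo)%E.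
    by rewrite EL leeDr.
  by rewrite -ge0_fin_numE// fin_num_measure.
rewrite EL E0L E1L -/L -/L' fineD// !fineM//=; lra.
Qed.

(** Each round keeps one digit and drops the next: these are the digits of [x] at positions 0, 2, 4,
    and so on, cut after [n] of them. *)
Fixpoint even_digits_approx n (x : RT) : R :=
  if n is n'.+1 then
    ((2^-1 <= x)%R%:R + even_digits_approx n' (doubling (doubling x))) / 2
  else 0.

Lemma even_digits_approx01 n x : 0 <= even_digits_approx n x <= 1.
Proof.
elim: n x => [|n IH] x /=; first by rewrite lexx ler01.
by have /andP[? ?] := IH (doubling (doubling x)); case: (2^-1 <= x) => /=; lra.
Qed.

Lemma even_digits_approx_nd x : nondecreasing_seq (even_digits_approx ^~ x).
Proof.
apply/nondecreasing_seqP => n; elim: n x => [|n IH] x.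
  by have /andP[] := even_digits_approx01 1 x.
by rewrite [leLHS]/= [leRHS]/=; have := IH (doubling (doubling x)) => /= ?; lra.
Qed.

Definition even_digits (x : RT) : RT := limn (even_digits_approx ^~ x).
Definition odd_digits (x : RT) : RT := even_digits (doubling x).

Lemma even_digits_cvg x : even_digits_approx n x @[n --> \oo] --> even_digits x.
Proof.
apply: nondecreasing_is_cvgn; first exact: even_digits_approx_nd.
by exists 1 => _ [n _ <-]; case/andP: (even_digits_approx01 n x).
Qed.

Lemma even_digits01 x : 0 <= even_digits x <= 1.
Proof.
apply/andP; split.
  apply: limr_ge; first exact: even_digits_cvg.
  by apply: nearW => n; case/andP: (even_digits_approx01 n x).
apply: limr_le; first exact: even_digits_cvg.
by apply: nearW => n; case/andP: (even_digits_approx01 n x).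
Qed.

(** Deleting a digit exchanges even and odd positions, so the pair of streams obeys a recursion in a
    single step. *)
Lemma even_digitsE x :
  even_digits x = ((2^-1 <= x)%R%:R + odd_digits (doubling x)) / 2.
Proof.
have h : even_digits_approx n.+1 x @[n --> \oo] --> even_digits x.
  by rewrite (cvg_shiftS (even_digits_approx ^~ x)); exact: even_digits_cvg.
apply: (cvg_unique _ h) => //=.
apply: cvgMl; apply: cvgD; first exact: cvg_cst.
exact: even_digits_cvg.
Qed.

Lemma measurable_even_digits : measurable_fun setT even_digits.
Proof.
apply: (@measurable_fun_cvg _ _ R _ even_digits_approx) => [n|x _]; last exact: even_digits_cvg.
elim: n => [|n IH] /=; first exact: measurable_cst.
apply: measurable_funM => //; apply: measurable_funD.
  rewrite (_ : (fun _ => _) = (fun x : RT => if 2^-1 <= x then 1 else 0)).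
    by apply: measurable_fun_ifT => //; exact: measurable_fun_ler.
  by apply/funext => x; case: ifP.
apply: measurableT_comp IH _.
by apply: measurableT_comp; exact: measurable_doubling.
Qed.


Lemma measurable_odd_digits : measurable_fun setT odd_digits.
Proof. exact: measurableT_comp measurable_even_digits measurable_doubling. Qed.

(** Tails of the joint law and of the uniform law. Both streams are nonnegative, so the argument
    [-1] imposes no constraint. *)
Let G (a b : R) := fine (unif01 [set x | a < even_digits x /\ b < odd_digits x]).
Let g (a : R) := fine (unif01 `]a, +oo[%classic).

Let mgt (f : RT -> RT) a : measurable_fun setT f -> measurable [set x | a < f x].
Proof.
move=> mf; have -> : [set x | a < f x] = setT `&` f @^-1` `]a, +oo[.
  by apply/seteqP; split => x /=; rewrite in_itv/= andbT => // -[].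
exact: mf.
Qed.

Let mG a b : measurable [set x | a < even_digits x /\ b < odd_digits x].
Proof.
by apply: measurableI; apply: mgt; [exact: measurable_even_digits|exact: measurable_odd_digits].
Qed.

Let fine01 (A : set RT) : measurable A -> 0 <= fine (unif01 A) <= 1.
Proof.
move=> mA; rewrite fine_ge0//=.
by rewrite -lee_fin fineK ?fin_num_measure// probability_le1.
Qed.

Let g_rec a : g a = (g (2 * a) + g (2 * a - 1)) / 2.
Proof.
apply: unif01_doubling => // x xh /=; rewrite !in_itv/= !andbT /doubling.
  by rewrite xh; lra.
have -> : (x < 2^-1) = false by rewrite ltNge xh.
by lra.
Qed.

(** A first digit [e] turns the constraint on the even stream into one on the odd stream with
    threshold [2 * a - e], and the odd constraint into an even one; hence the swapped arguments. *)
Let G_rec a b : G a b = (G b (2 * a) + G b (2 * a - 1)) / 2.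
Proof.
apply: unif01_doubling => // x xh /=; rewrite (even_digitsE x) /odd_digits.
  have -> : (2^-1 <= x) = false by rewrite leNgt xh.
  by move=> /=; split => -[? ?]; split; lra.
by rewrite xh/=; split => -[? ?]; split; lra.
Qed.

Let g_ge1 a : 1 <= a -> g a = 0.
Proof.
move=> a1; rewrite /g /unif01 /mrestr (_ : _ `&` _ = set0) ?measure0//.
by apply/seteqP; split => // x /=; rewrite !in_itv/= andbT => -[]; lra.
Qed.

Let g_lt0 a : a < 0 -> g a = 1.
Proof.
move=> a0; rewrite /g /unif01 /mrestr (_ : _ `&` _ = `[0%R, 1%R[%classic).
  by rewrite lebesgue_measure_itv/= lte01 oppr0 adde0.
by apply/seteqP; split => x /=; rewrite !in_itv/= andbT; [case|lra].
Qed.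

Let G_ge1r a b : 1 <= b -> G a b = 0.
Proof.
move=> b1; rewrite /G (_ : [set _ | _] = set0) ?measure0//.
apply/seteqP; split => // x /= -[_].
by have /andP[_] := even_digits01 (doubling x); rewrite /odd_digits; lra.
Qed.

Let G_lt0r a b : b < 0 -> G a b = G a (-1).
Proof.
move=> b0; congr (fine (unif01 _)); apply/seteqP.
have od x : 0 <= odd_digits x by case/andP: (even_digits01 (doubling x)).
by split => x /= -[? _]; split => //; have := od x; lra.
Qed.

Let G_lt0l b : G (-1) b = G b (-1).
Proof. by rewrite G_rec !(@G_lt0r b (_ - _)) ?(@G_lt0r b (_ * _)); lra. Qed.

(** Following the chain of points [z'] for [n] steps bounds [f z] by [2 ^ - n]. *)
Let halving_eq0 (T : Type) (f : T -> R) : (forall z, `|f z| <= 1) ->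
  (forall z, exists z', `|f z| <= `|f z'| / 2) -> forall z, f z = 0.
Proof.
move=> f1 fh z; have H n : forall z, `|f z| <= geometric 1 2^-1 n.
  elim: n => [|n IH] {}z; first by rewrite /= expr0 mulr1.
  have [z' h] := fh z; have := IH z'; rewrite /= exprS; lra.
apply/eqP; rewrite -normr_le0.
have h : @geometric R 1 2^-1 n @[n --> \oo] --> 0.
  by apply: cvg_geometric; rewrite ger0_norm; lra.
rewrite -(cvg_lim _ h)//; apply: limr_ge; first exact: cvgP h.
exact: nearW.
Qed.

Let g01 a : 0 <= g a <= 1. Proof. exact: fine01. Qed.
Let G01 a b : 0 <= G a b <= 1. Proof. exact: fine01. Qed.

(* Both sides satisfy the same functional equation, in which one of the two
   terms is always trivial; hence their difference is at most half of itself. *)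
Let G_marginal a : G a (-1) = g a.
Proof.
apply/eqP; rewrite -subr_eq0; apply/eqP; move: a.
apply: halving_eq0 => a.
  by rewrite ler_norml; have := g01 a; have := G01 a (-1); lra.
rewrite G_rec !G_lt0l g_rec.
have [a2|a2] := leP 1 (2 * a).
  exists (2 * a - 1); rewrite -G_lt0l G_ge1r// g_ge1// !add0r -mulrBl normrM.
  by rewrite (@ger0_norm _ 2^-1)//; lra.
exists (2 * a); rewrite (@g_lt0 (2 * a - 1)); last by lra.
rewrite -(@G_lt0l (2 * a - 1)) (@G_lt0r _ (2 * a - 1)); last by lra.
rewrite (_ : G (-1) (-1) = 1).
  rewrite [X in `|X| <= _](_ : _ = (G (2 * a) (-1) - g (2 * a)) / 2); last by lra.
  by rewrite normrM (@ger0_norm _ 2^-1)//; lra.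
rewrite /G (_ : [set _ | _] = setT) ?probability_setT//.
have ed x : 0 <= even_digits x by case/andP: (even_digits01 x).
apply/seteqP; split => // x _ /=.
by have := ed x; have := ed (doubling x); rewrite /odd_digits; split; lra.
Qed.

(** The contraction argument again, now on pairs: [(a, b)] passes to [(b, 2 * a - e)]. If
    [1 <= 2 * a], the terms of digit 0 vanish; otherwise those of digit 1 reduce to [G b (-1)] and
    [g b], which agree by [G_marginal]. *)
Let G_joint a b : G a b = g a * g b.
Proof.
apply/eqP; rewrite -subr_eq0; apply/eqP.
pose f (z : R * R) := G z.1 z.2 - g z.1 * g z.2.
suff : forall z, f z = 0 by move/(_ (a, b)).
apply: halving_eq0 => -[{}a {}b]; rewrite /f /=.
  have /andP[? ?] := g01 a; have /andP[? ?] := g01 b; have := G01 a b.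
  have : 0 <= g a * g b <= 1 by rewrite mulr_ge0//= mulr_ile1.
  by rewrite ler_norml; lra.
rewrite G_rec (g_rec a).
have [a2|a2] := leP 1 (2 * a).
  exists (b, 2 * a - 1) => /=; rewrite G_ge1r// g_ge1// !add0r.
  by rewrite mulrAC -mulrBl normrM (@ger0_norm _ 2^-1)// [g b * _]mulrC; lra.
exists (b, 2 * a) => /=; rewrite (@g_lt0 (2 * a - 1)); last by lra.
rewrite (@G_lt0r b (2 * a - 1)); last by lra.
rewrite G_marginal [X in `|X|](_ : _ = (G b (2 * a) - g b * g (2 * a)) / 2); last by lra.
by rewrite normrM (@ger0_norm _ 2^-1)//; lra.
Qed.

Lemma unif01_split (A B : set RT) : measurable A -> measurable B ->
  unif01 (even_digits @^-1` A `&` odd_digits @^-1` B) = (unif01 A * unif01 B)%E.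
Proof.
move=> mA mB.
apply: joint_law_ray => //.
- exact: measurable_even_digits.
- exact: measurable_odd_digits.
move=> a b.
rewrite (_ : _ `&` _ = [set x | a < even_digits x /\ b < odd_digits x]); last first.
  by apply/seteqP; split => x /=; rewrite !in_itv/= !andbT.
transitivity (G a b)%:E; first by rewrite /G fineK//; exact: fin_num_measure.
by rewrite G_joint EFinM /g !fineK//; exact: fin_num_measure.
Qed.

End digit_splitting.

(** * Sampling from a law on the line by its quantile function *)

Section quantile.
Context {R : realType}.
Local Notation RT := (measurableTypeR R).
Variable Q : probability RT R.

Let F (x : R) : R := fine (Q `]-oo, x]%classic).

Let FE x : (F x)%:E = Q `]-oo, x]%classic.
Proof. by rewrite fineK//; exact: fin_num_measure. Qed.

Let F_nd x y : x <= y -> F x <= F y.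
Proof.
move=> xy; rewrite -lee_fin !FE; apply: le_measure; rewrite ?inE//.
by apply: subset_itvl; rewrite bnd_simp.
Qed.

(** Outside []0, 1[] the set can be empty or unbounded below, hence the default value [0]; within
    [[0, 1[] this concerns the null point [0] alone. *)
Definition quantile (y : RT) : RT :=
  if 0 < y < 1 then inf [set x | y <= F x] else 0.

Let mid : measurable_fun [set: RT] (fun x : RT => x : R).
Proof. exact: measurable_id. Qed.

(** The identity has law [Q], so [F] is its distribution function and has the usual limits and
    right-continuity. *)
Let idRV : {RV Q >-> R} :=
  HB.pack (fun x : RT => x : R) (isMeasurableFun.Build _ _ _ _ _ mid).

Let F_Ny y : 0 < y -> exists x, F x < y.
Proof.
move=> y0; have /fine_cvgP[_ h] := @cvg_cdfNy0 _ _ R Q idRV.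
have /= := cvgr_lt _ h _ y0.
by move=> [M [_ H]]; exists (M - 1); apply: H; lra.
Qed.

Let F_y y : y < 1 -> exists x, y < F x.
Proof.
move=> y0; have /fine_cvgP[_ h] := @cvg_cdfy1 _ _ R Q idRV.
have /= := cvgr_gt _ h _ y0.
by move=> [M [_ H]]; exists (M + 1); apply: H; lra.
Qed.

Let F_right x y : (forall x', x < x' -> y <= F x') -> y <= F x.
Proof.
move=> h; have /fine_cvgP[_ hc] : cdf idRV x' @[x' --> x^'+] --> (F x)%:E.
  by rewrite FE; exact: (@cdf_right_continuous _ _ R Q idRV x).
rewrite -(cvg_lim _ hc)//; apply: limr_ge; first exact: cvgP hc.
by near=> x'; apply: h; near: x'; exact: nbhs_right_gt.
Unshelve. all: by end_near. Qed.

(** The Galois connection between a distribution function and its quantile; right-continuity puts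
    the infimum itself in the set. *)
Lemma quantile_gt (y a : R) : 0 < y < 1 -> (a < quantile y) = (F a < y).
Proof.
move=> y01; rewrite /quantile y01; apply/idP/idP; apply: contraLR; rewrite -!leNgt => h.
  apply: ge_inf => //=.
  have /andP[/F_Ny[x xy] _] := y01; exists x => z /= yz.
  by rewrite leNgt; apply/negP => /ltW/F_nd; lra.
apply: F_right => x' ax'.
have hi : has_inf [set x | y <= F x].
  split.
    by have /andP[_ /F_y[x xy]] := y01; exists x => /=; exact: ltW.
  have /andP[/F_Ny[x xy] _] := y01; exists x => z /= yz.
  by rewrite leNgt; apply/negP => /ltW/F_nd; lra.
have /(inf_adherent)/(_ hi)[z /= yz zlt] : 0 < x' - a by lra.
by apply: le_trans yz _; apply: F_nd; lra.
Qed.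

Lemma measurable_quantile : measurable_fun setT quantile.
Proof.
apply: (measurability (@RGenOInfty.G R)); first exact: RGenOInfty.measurableE.
move=> _ [_ [a ->] <-].
(* The default value [0] lies above [a] exactly when [a < 0]. *)
rewrite setTI (_ : _ @^-1` _ = (`]0, 1[ `&` `]F a, +oo[) `|`
   (~` `]0, 1[ `&` (if a < 0 then setT else set0))).
  apply: measurableU; first exact: measurableI.
  by apply: measurableI; [exact: measurableC|case: ifP].
apply/seteqP; split => y /=; rewrite !in_itv/= !andbT.
  have [y01|y01] := boolP (0 < y < 1); first by rewrite quantile_gt//; left.
  by rewrite /quantile (negbTE y01) => a0; right; rewrite a0.
case=> -[y01]; first by rewrite quantile_gt.
by rewrite /quantile; move: y01 => /negP/negbTE ->; case: ifPn.
Qed.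

Lemma quantile_law A : measurable A -> unif01 (quantile @^-1` A) = Q A.
Proof.
move=> mA; rewrite -[LHS]/(pushforward unif01 quantile A).
apply: measure_unique_ray => //; first exact: measurable_quantile.
  move=> mq; rewrite -ge0_fin_numE//.
  by rewrite -[X in X \is a _]/(unif01 setT) probability_setT.
move=> mq a; rewrite -[LHS]/(unif01 (quantile @^-1` `]a, +oo[)).
have /andP[F0 F1] : 0 <= F a <= 1.
  by rewrite -!lee_fin FE measure_ge0 probability_le1.
rewrite -setCitvl -[RHS]/(Q (~` `]-oo, a])) (@probability_setC _ _ _ Q)//.
transitivity ((1 - F a)%:E); last by rewrite EFinB FE.
(* The singleton accounts for the default value at the left end of [[0, 1[]. *)
have -> : unif01 (quantile @^-1` (~` `]-oo, a])) =
    lebesgue_measure (`]F a, 1[ `|` (if a < 0 then [set 0] else set0)).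
  rewrite setCitvl; congr (lebesgue_measure _); apply/seteqP; split => y /=.
    rewrite !in_itv/= !andbT => -[qy /andP[]].
    rewrite le_eqVlt => /predU1P[y0 _|y0 y1].
      by right; move: qy; rewrite /quantile -y0 ltxx/= => ->.
    by left; rewrite y1 andbT -quantile_gt// y0.
  rewrite !in_itv/= !andbT => -[/andP[Fy y1]|].
    by rewrite y1 andbT quantile_gt ?Fy ?y1 ?andbT; [split => //|]; lra.
  by case: ifPn => //= a0 ->; rewrite /quantile ltxx/= lexx ltr01.
rewrite measureU0//; last 2 first.
- by case: ifP.
- by case: ifP => _; [exact: lebesgue_measure_set1|exact: measure0].
rewrite -[LHS]/(lebesgue_measure `]F a, 1[%classic) lebesgue_measure_itv/= lte_fin; case: ltP => // aF.
by congr EFin; lra.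
Qed.

End quantile.

(** * A branching Gaussian space *)

Section joint_law.
Context {R : realType} d1 d2 d (T1 : measurableType d1) (T2 : measurableType d2)
  (T : measurableType d).
Variables (P : probability T R) (P1 : probability T1 R) (P2 : probability T2 R).
Variables (X : T -> T1) (Y : T -> T2).
Hypotheses (mX : measurable_fun setT X) (mY : measurable_fun setT Y).
Hypothesis PXY : forall A B, measurable A -> measurable B ->
  P (X @^-1` A `&` Y @^-1` B) = (P1 A * P2 B)%E.

Let mXY : measurable_fun setT (fun w => (X w, Y w)).
Proof. exact: measurable_fun_pair. Qed.

Lemma joint_law (K : set (T1 * T2)) : measurable K ->
  P [set w | K (X w, Y w)] = (P1 \x P2)%E K.
Proof.
move=> mK; rewrite -[LHS]/(pushforward P (fun w => (X w, Y w)) K).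
by apply/esym; apply: product_measure_unique => // A B mA mB; exact: PXY.
Qed.

Lemma ge0_integral_joint_law (f : T1 * T2 -> \bar R) :
  measurable_fun setT f -> (forall z, 0 <= f z)%E ->
  (\int[P]_w f (X w, Y w) = \int[P1]_x \int[P2]_y f (x, y))%E.
Proof.
move=> mf f0.
transitivity (\int[(P1 \x P2)%E]_z f z)%E; last exact: fubini_tonelli1.
have := @ge0_integral_pushforward _ _ _ _ _ _ mXY P setT f measurableT mf (fun x _ => f0 x).
rewrite preimage_setT => <-.
by apply: eq_measure_integral => A mA _; exact: joint_law.
Qed.

End joint_law.

(* A Gaussian value, together with two independent copies of the whole system
   whose values are the two halves of the original value, suitably rescaled. *)
Record gaussian_branching {R : realType} d (E : measurableType d)
    (P : probability E R) := GaussianBranching {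
  gb_value : E -> R ;
  gb_left : E -> E ;
  gb_right : E -> E ;
  measurable_gb_value : measurable_fun setT gb_value ;
  measurable_gb_left : measurable_fun setT gb_left ;
  measurable_gb_right : measurable_fun setT gb_right ;
  gb_law : forall A, measurable A -> P (gb_value @^-1` A) = normal_prob 0 1 A ;
  gb_indep : forall C D, measurable C -> measurable D ->
    P (gb_left @^-1` C `&` gb_right @^-1` D) = (P C * P D)%E ;
  gb_split : forall w,
    gb_value (gb_left w) + gb_value (gb_right w) = Num.sqrt 2 * gb_value w }.

Section seed.
Context {R : realType}.
Local Notation RT := (measurableTypeR R).
Local Notation N01 := (@normal_prob R 0 1).

(* The state (x, w) consists of a Gaussian value and of a uniform source of
   randomness, from which a fresh Gaussian and two fresh sources are extracted. *)
Theorem gaussian_branching_exists : exists d (E : measurableType d)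
  (P : probability E R), inhabited (gaussian_branching P).
Proof.
pose q : RT -> RT := quantile N01.
have mq : measurable_fun setT q by exact: measurable_quantile.
have me := @measurable_even_digits R; have mo := @measurable_odd_digits R.
pose c : R := (Num.sqrt 2)^-1.
have s2 : Num.sqrt (2 : R) ^+ 2 = 2 by rewrite sqr_sqrtr.
have s20 : Num.sqrt (2 : R) != 0 by rewrite sqrtr_eq0 -ltNge.
have cc : c ^+ 2 + c ^+ 2 = 1 by rewrite /c exprVn s2; lra.
pose Phi0 (z : RT * RT) : RT * RT :=
  (c * z.1 + c * q (even_digits z.2), even_digits (odd_digits z.2)).
pose Phi1 (z : RT * RT) : RT * RT :=
  (c * z.1 - c * q (even_digits z.2), odd_digits (odd_digits z.2)).
have mqe : measurable_fun setT (fun z : RT * RT => c * q (even_digits z.2)).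
  apply: (@measurable_funM _ _ R) => //; apply: (measurableT_comp mq).
  exact: (measurableT_comp me).
have mPhi0 : measurable_fun setT Phi0.
  apply: measurable_fun_pair.
    by apply: (@measurable_funD _ _ R) => //; exact: (@measurable_funM _ _ R).
  by apply: (measurableT_comp me); exact: (measurableT_comp mo).
have mPhi1 : measurable_fun setT Phi1.
  apply: measurable_fun_pair.
    by apply: (@measurable_funB _ _ R) => //; exact: (@measurable_funM _ _ R).
  by apply: (measurableT_comp mo); exact: (measurableT_comp mo).
pose P : probability (RT * RT)%type R := (N01 \x @unif01 R)%E.
exists _, (RT * RT)%type, P; split.
apply: (@GaussianBranching R _ (RT * RT)%type P fst Phi0 Phi1) => //.
- move=> A mA; rewrite (_ : _ @^-1` _ = A `*` setT); last first.
    by apply/seteqP; split => -[x y] //= -[].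
  apply: (etrans (@product_measure1E _ _ RT RT R N01 (@unif01 R) _ _ mA measurableT)).
  exact: (etrans (congr1 (mule _) (probability_setT (@unif01 R))) (mule1 _)).
- move=> C D mC mD.
  (* The probability that a state with value [x] and a fresh uniform source lies in [C]. *)
  pose gC (x : RT) := fine (unif01 (xsection C x)).
  pose gD (x : RT) := fine (unif01 (xsection D x)).
  have fing (K : set (RT * RT)) x : measurable K -> unif01 (xsection K x) \is a fin_num.
    by move=> mK; apply: fin_num_measure; exact: measurable_xsection.
  have g01 (K : set (RT * RT)) x : measurable K -> 0 <= fine (unif01 (xsection K x)) <= 1.
    move=> mK; rewrite fine_ge0//= -lee_fin fineK ?fing//.
    by apply: probability_le1; exact: measurable_xsection.
  have mg (K : set (RT * RT)) : measurable K ->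
      measurable_fun setT (fun x : RT => fine (unif01 (xsection K x))).
    by move=> mK; apply: measurableT_comp => //; exact: measurable_fun_xsection.
  have PE (K : set (RT * RT)) : measurable K ->
      P K = (\int[N01]_x (fine (unif01 (xsection K x)))%:E)%E.
    by move=> mK; apply: eq_integral => x _ /=; rewrite fineK// fing.
  pose F (z : RT * RT) := gC z.1 * gD z.2.
  have F01 z : 0 <= F z <= 1.
    have /andP[? ?] := g01 C z.1 mC; have /andP[? ?] := g01 D z.2 mD.
    by rewrite mulr_ge0//= mulr_ile1.
  have mF : measurable_fun setT F.
    apply: measurable_funM.
      exact: (measurableT_comp (mg _ mC)).
    exact: (measurableT_comp (mg _ mD)).
  (* The two fresh sources are integrated out first. What remains depends only on the pair of new
     values, which [gaussian_rotation] with both coefficients equal to [c] turns into an independent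
     pair. *)
  transitivity (\int[N01]_x \int[N01]_y (F (c * x + c * y, c * x - c * y)%R)%:E)%E.
    apply: eq_integral => x _.
    pose m1 (u : RT) : RT := c * x + c * q u.
    pose m2 (u : RT) : RT := c * x - c * q u.
    pose K : set (RT * RT) :=
      [set z | C (m1 z.1, even_digits z.2) /\ D (m2 z.1, odd_digits z.2)].
    have mm1 : measurable_fun setT m1.
      by apply: (@measurable_funD _ _ R) => //; exact: (@measurable_funM _ _ R).
    have mm2 : measurable_fun setT m2.
      by apply: (@measurable_funB _ _ R) => //; exact: (@measurable_funM _ _ R).
    have mK : measurable K.
      apply: measurableI; rewrite -[X in measurable X]setTI.
        have m : measurable_fun setT (fun z : RT * RT => (m1 z.1, even_digits z.2)).
          by apply: measurable_fun_pair; [exact: (measurableT_comp mm1)|exact: (measurableT_comp me)].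
        exact: m.
      have m : measurable_fun setT (fun z : RT * RT => (m2 z.1, odd_digits z.2)).
        by apply: measurable_fun_pair; [exact: (measurableT_comp mm2)|exact: (measurableT_comp mo)].
      exact: m.
    transitivity (unif01 [set w | K (even_digits w, odd_digits w)]).
      congr (unif01 _); apply/seteqP; rewrite /xsection.
      by split => w /=; rewrite in_setE.
    rewrite (joint_law me mo (@unif01_split R) mK).
    pose h (y : RT) := (F (c * x + c * y, c * x - c * y))%:E.
    have mh : measurable_fun setT h.
      apply/measurable_EFinP; apply: (measurableT_comp mF).
      apply: measurable_fun_pair.
        by apply: (@measurable_funD _ _ R) => //; exact: (@measurable_funM _ _ R).
      by apply: (@measurable_funB _ _ R) => //; exact: (@measurable_funM _ _ R).
    have h0 y : (0 <= h y)%E by rewrite lee_fin; case/andP: (F01 (c * x + c * y, c * x - c * y)).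
    transitivity (\int[unif01]_u h (q u))%E; last first.
      have := @ge0_integral_pushforward _ _ _ _ _ _ mq (@unif01 R) setT h measurableT mh (fun x _ => h0 x).
      rewrite preimage_setT => <-.
      by apply: eq_measure_integral => A mA _; exact: quantile_law.
    apply: eq_integral => u _.
    transitivity (unif01 (even_digits @^-1` (xsection C (m1 u)) `&`
                          odd_digits @^-1` (xsection D (m2 u)))).
      congr (unif01 _); apply/seteqP; rewrite /xsection.
      by split => w /=; rewrite !in_setE.
    rewrite unif01_split; [|exact: measurable_xsection..].
    by rewrite /h /F EFinM /gC /gD !fineK//; exact: fing.
  have c0 : c != 0 by rewrite invr_eq0.
  rewrite (gaussian_rotation cc c0 mF F01) !PE//.
  have gC0 x : (0 <= (gC x)%:E)%E by case/andP: (g01 C x mC).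
  have gD0 x : (0 <= (gD x)%:E)%E by case/andP: (g01 D x mD).
  have mgC : measurable_fun setT (EFin \o gC) by apply/measurable_EFinP; exact: mg.
  have mgD : measurable_fun setT (EFin \o gD) by apply/measurable_EFinP; exact: mg.
  have ID0 : (0 <= \int[N01]_y (gD y)%:E)%E by exact: integral_ge0.
  rewrite -[RHS](ge0_integralZr N01 measurableT mgC (fun x _ => gC0 x) ID0).
  apply: eq_integral => x _.
  rewrite -(ge0_integralZl N01 measurableT mgD (fun x _ => gD0 x) (gC0 x)).
  by apply: eq_integral => y _; rewrite /F EFinM.
- move=> [x w]; rewrite /Phi0 /Phi1 /=.
  rewrite addrACA subrr addr0 -mulrDl; congr (_ * _).
  by apply: (mulfI s20); rewrite mulrDr mulfV// -expr2 s2.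
Qed.

End seed.

(** * Dyadic increments *)

Section independence.
Context d (T : measurableType d) (R : realType) (P : probability T R).

(** With [B] frozen, both sides are finite measures in [A], so the generating pi-system decides. *)
Let indep_sigmal (C : set_system T) (B : set T) : C `<=` measurable ->
  setI_closed C -> C setT -> measurable B ->
  (forall A, C A -> P (A `&` B) = (P A * P B)%E) ->
  forall A, <<s C >> A -> P (A `&` B) = (P A * P B)%E.
Proof.
move=> mC CI CT mB CB A CA.
have PB : P B \is a fin_num by exact: fin_num_measure.
pose c := NngNum (fine_ge0 (measure_ge0 P B)).
have -> : (P A * P B = mscale c P A)%E by rewrite /mscale/= fineK// muleC.
rewrite -[LHS]/(mrestr P mB A).
apply: (@g_sigma_algebra_measure_unique _ _ _ C mC (fun=> setT)) => //.
- by rewrite bigcup_const.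
- by move=> S CS; rewrite /= /mrestr /mscale/= fineK// muleC CB.
- move=> k; rewrite -ge0_fin_numE//; exact: fin_num_measure.
Qed.

Lemma independent_classes_sigma (C D : set_system T) :
  C `<=` measurable -> setI_closed C -> C setT ->
  D `<=` measurable -> setI_closed D -> D setT ->
  independent_classes P C D -> independent_classes P <<s C >> <<s D >>.
Proof.
move=> mC CI CT mD DI DT CD A B sA sB.
have mB : measurable B.
  by apply: (smallest_sub _ mD) sB; exact: sigma_algebra_measurable.
apply: (@indep_sigmal C) => // {sA}A CA.
rewrite setIC muleC; apply: (@indep_sigmal D) => //; first exact: mC.
by move=> {sB mB}B DB; rewrite setIC muleC CD.
Qed.

End independence.

Section increments.
Context {R : realType} d (E : measurableType d) (P : probability E R).
Local Notation RT := (measurableTypeR R).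
Local Notation N01 := (@normal_prob R 0 1).
Variable br : gaussian_branching P.
Local Notation Z := (gb_value br).
Local Notation Phi0 := (gb_left br).
Local Notation Phi1 := (gb_right br).

(* [incr n k / sqrt 2 ^ n] is the increment of the Brownian motion over the
   dyadic interval [[k / 2 ^ n, (k + 1) / 2 ^ n]] of [[0, 1]]. *)
Fixpoint incr (n k : nat) (w : E) : R :=
  if n is n'.+1 then
    if (k < 2 ^ n')%N then incr n' k (Phi0 w) else incr n' (k - 2 ^ n')%N (Phi1 w)
  else if k == 0%N then Z w else 0.

(** Lets the bounds on increments hold for every index, as the dyadic path argument requires. *)
Lemma incr_ge n k w : (2 ^ n <= k)%N -> incr n k w = 0.
Proof.
elim: n k w => [|n IH] k w /=; first by case: k.
rewrite expnS mul2n -addnn => kn.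
by rewrite ltnNge (leq_trans (leq_addl _ _) kn)/= IH// leq_subRL ?(leq_trans (leq_addl _ _) kn).
Qed.

(** [incr] unfolds at the root of the binary tree, whereas refinement takes place at its leaves; the
    induction descends to the leaf, where [gb_split] applies. *)
Lemma incr_split n k w :
  incr n.+1 k.*2 w + incr n.+1 k.*2.+1 w = Num.sqrt 2 * incr n k w.
Proof.
elim: n k w => [|n IH] k w.
  by case: k => [|k] /=; [exact: gb_split|rewrite addr0 mulr0].
have incrS m j : incr m.+1 j w = if (j < 2 ^ m)%N then incr m j (Phi0 w)
    else incr m (j - 2 ^ m)%N (Phi1 w) by [].
rewrite !(incrS n.+1) (incrS n k).
rewrite expnS mul2n ltn_double ltn_Sdouble; case: ltnP => kn; first exact: IH.
by rewrite subSn ?leq_double// -doubleB IH.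
Qed.

Lemma measurable_incr n k : measurable_fun setT (incr n k).
Proof.
elim: n k => [|n IH] k.
  by case: k => [|k]; [exact: measurable_gb_value|exact: measurable_cst].
apply: (eq_measurable_fun (fun w => if (k < 2 ^ n)%N then incr n k (Phi0 w)
    else incr n (k - 2 ^ n)%N (Phi1 w))) => //.
case: (k < 2 ^ n)%N; apply: measurableT_comp (IH _) _.
  exact: measurable_gb_left.
exact: measurable_gb_right.
Qed.

Let all_incr n (A : nat -> set R) :=
  [set w | forall k, (k < 2 ^ n)%N -> A k (incr n k w)].

Let measurable_all_incr (I : pred nat) n (A : nat -> set R) :
  (forall k, measurable (A k)) ->
  measurable [set w | forall k, I k -> A k (incr n k w)].
Proof.
move=> mA; rewrite (_ : [set _ | _] = \bigcap_(k in [set` I]) (incr n k @^-1` A k)); last first.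
  by apply/seteqP; split.
apply: bigcap_measurableType => k _.
rewrite -[X in measurable X]setTI; exact: measurable_incr.
Qed.

(** The first half of the increments depends on the left copy and the second half on the right copy,
    so [gb_indep] splits the product in two. This gives laws and independence at once. *)
Lemma all_incr_prob n (A : nat -> set R) : (forall k, measurable (A k)) ->
  P (all_incr n A) = (\prod_(0 <= k < 2 ^ n) N01 (A k))%E.
Proof.
elim: n A => [|n IH] A mA.
  rewrite expn0 big_nat1 -(gb_law br)//; congr (P _); apply/seteqP; split => w /=.
    exact.
  by move=> ? [].
rewrite (_ : all_incr _ _ = Phi0 @^-1` (all_incr n A) `&`
    Phi1 @^-1` (all_incr n (fun k => A (k + 2 ^ n)%N))); last first.
  rewrite /all_incr expnS mul2n -addnn; apply/seteqP; split => w /=.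
    move=> h; split => k kn.
      by have := h k; rewrite kn; apply; rewrite ltn_addl.
    have := h (k + 2 ^ n)%N; rewrite ltn_add2r kn ltnNge leq_addl addnK/=.
    by apply.
  move=> [h1 h2] k kn; case: ltnP => [|nk]; first exact: h1.
  by rewrite -{1}(subnK nk); apply: h2; rewrite ltn_subLR.
rewrite gb_indep; [|exact: measurable_all_incr..].
rewrite !IH// expnS mul2n -addnn (big_cat_nat (leq0n (2 ^ n)%N) (leq_addr (2 ^ n)%N (2 ^ n)%N))/=.
congr (_ * _)%E.
rewrite [RHS](_ : _ = \prod_(0 + 2 ^ n <= k < 2 ^ n + 2 ^ n) N01 (A k))%E; last by rewrite add0n.
by rewrite big_addn addnK.
Qed.

(** Simultaneous constraints rather than constraints on one increment, because independence is
    extended from a family stable under intersection. *)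
Definition incr_cylinder (I : pred nat) n : set_system E :=
  [set S | exists2 A : nat -> set R, (forall k, measurable (A k)) &
    S = [set w | forall k, I k -> A k (incr n k w)]].

Lemma incr_cylinder_measurable I n : incr_cylinder I n `<=` measurable.
Proof. by move=> _ [A mA ->]; exact: measurable_all_incr. Qed.

Let incr_cylinderI I n : setI_closed (incr_cylinder I n).
Proof.
move=> _ _ [A mA ->] [B mB ->].
exists (fun k => A k `&` B k); first by move=> k; exact: measurableI.
apply/seteqP; split => w /=; first by move=> [hA hB] k Ik; split; [exact: hA|exact: hB].
by move=> h; split => k /h[].
Qed.

Let incr_cylinderT I n : incr_cylinder I n setT.
Proof. by exists (fun=> setT) => //; apply/seteqP; split. Qed.

Let restrict (I : pred nat) (A : nat -> set R) k := if I k then A k else setT.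

Let incr_cylinder_prob (I : pred nat) n (A : nat -> set R) :
  (forall k, measurable (A k)) -> (forall k, I k -> (k < 2 ^ n)%N) ->
  P [set w | forall k, I k -> A k (incr n k w)] =
  (\prod_(0 <= k < 2 ^ n) N01 (restrict I A k))%E.
Proof.
move=> mA In; rewrite -all_incr_prob; last by move=> k; rewrite /restrict; case: ifP.
congr (P _); apply/seteqP; rewrite /all_incr /restrict; split => w /= h k.
  by move=> _; case: ifPn => // /h.
by move=> Ik; have := h k (In _ Ik); rewrite Ik.
Qed.

Definition incr_sigma (I : pred nat) n : set_system E := <<s incr_cylinder I n >>.

(** For disjoint index sets, two cylinders meet in a cylinder over the union, and each factor of its
    product formula is constrained by at most one of them. *)
Lemma incr_sigma_indep (I J : pred nat) n :
  (forall k, I k -> (k < 2 ^ n)%N) -> (forall k, J k -> (k < 2 ^ n)%N) ->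
  (forall k, ~~ (I k && J k)) ->
  independent_classes P (incr_sigma I n) (incr_sigma J n).
Proof.
have mcyl := incr_cylinder_measurable.
move=> In Jn IJ; apply: independent_classes_sigma => // _ _ [A mA ->] [B mB ->].
rewrite !incr_cylinder_prob// -big_split/=.
rewrite (_ : _ `&` _ = [set w | forall k, (I k || J k) ->
    (if I k then A k else B k) (incr n k w)]); last first.
  apply/seteqP; split => w /=.
    by move=> [hA hB] k; case: ifPn => [/hA|_ /= /hB].
  move=> h; split => k Ik; first by have := h k; rewrite Ik; exact.
  have := h k; rewrite Ik orbT; have := IJ k; rewrite Ik andbT => /negbTE ->.
  exact.
rewrite (@incr_cylinder_prob (fun k => I k || J k) n (fun k => if I k then A k else B k)); last 2 first.
- by move=> k; case: ifP.
- by move=> k /orP[/In|/Jn].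
apply: eq_bigr => k _; rewrite /restrict; have := IJ k.
by case: (I k); case: (J k) => //= _; rewrite probability_setT ?mule1 ?mul1e.
Qed.

Lemma incr_sigma_incr (I : pred nat) n k :
  I k -> measurable_fun setT (incr n k : g_sigma_algebraType (incr_cylinder I n) -> R).
Proof.
move=> Ik _ A mA; rewrite setTI; apply: sub_sigma_algebra.
exists (fun j => if j == k then A else setT); first by move=> j; case: ifP.
apply/seteqP; split => w /=; first by move=> Aw j Ij; case: eqP => // ->.
by move/(_ _ Ik); rewrite eqxx.
Qed.

Lemma incr_law n k (A : set R) : (k < 2 ^ n)%N -> measurable A ->
  P (incr n k @^-1` A) = N01 A.
Proof.
move=> kn mA; elim: n k kn => [|n IH] k kn.
  by case: k kn => // _; exact: gb_law.
have mpre j : measurable (incr n j @^-1` A).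
  by rewrite -[X in measurable X]setTI; exact: measurable_incr.
have [kn'|kn'] := ltnP k (2 ^ n)%N.
  rewrite -(IH k kn') (_ : _ @^-1` _ = Phi0 @^-1` (incr n k @^-1` A) `&` Phi1 @^-1` setT).
    by rewrite gb_indep// probability_setT mule1.
  by rewrite preimage_setT setIT; apply/funext => w /=; rewrite /preimage/= kn'.
have kn'' : (k - 2 ^ n < 2 ^ n)%N by rewrite ltn_subLR// addnn -mul2n -expnS.
rewrite -(IH _ kn'').
rewrite (_ : _ @^-1` _ = Phi0 @^-1` setT `&` Phi1 @^-1` (incr n (k - 2 ^ n)%N @^-1` A)).
  by rewrite gb_indep// probability_setT mul1e.
by rewrite preimage_setT setTI; apply/funext => w /=; rewrite /preimage/= ltnNge kn'.
Qed.

End increments.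

(** * Gaussian law of sums of increments *)

Section gaussian_sum.
Context {R : realType}.
Local Notation RT := (measurableTypeR R).
Local Notation N01 := (@normal_prob R 0 1).

(** With coefficients [1 / t] and [s / t], where [t = sqrt (1 + s ^ 2)], the rotation turns
    [y + s * x] into [t] times a single coordinate. *)
Lemma gaussian_sum_law (s : R) (A : set RT) : measurable A ->
  (\int[N01]_y \int[N01]_x (\1_A (y + s * x)%R)%:E =
   N01 [set z | A (Num.sqrt (1 + s ^+ 2) * z)%R])%E.
Proof.
move=> mA.
pose t := Num.sqrt (1 + s ^+ 2).
have t0 : t != 0 by rewrite sqrtr_eq0 -ltNge ltr_wpDr// sqr_ge0.
have t2 : t ^+ 2 = 1 + s ^+ 2 by rewrite sqr_sqrtr// addr_ge0// sqr_ge0.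
pose F (z : RT * RT) : R := \1_A (t * z.1).
have mt : measurable_fun setT (fun z : RT => (t * z : RT)).
  exact: (@measurable_funM _ _ R).
have mF : measurable_fun setT F.
  apply: (measurableT_comp (@measurable_indic _ _ R setT A mA)).
  exact: (measurableT_comp mt).
have F01 z : 0 <= F z <= 1 by rewrite /F indicE; case: (_ \in _); rewrite /= ?lexx ?ler01.
have ab : t^-1 ^+ 2 + (s / t) ^+ 2 = 1.
  by rewrite exprMn -{1}[t^-1 ^+ 2]mul1r -mulrDl -t2 -exprMn mulfV// expr1n.
have tV0 : t^-1 != 0 by rewrite invr_eq0.
have := gaussian_rotation ab tV0 mF F01.
rewrite /F /= => H; transitivity (\int[N01]_x \int[N01]_y (\1_A (t * x)%R)%:E)%E.
  rewrite -H; apply: eq_integral => x _; apply: eq_integral => y _.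
  refine (congr1 EFin _); refine (congr1 (\1_A) _); field.
  by [].
transitivity (\int[N01]_x (\1_[set z | A (t * z)%R] x)%:E)%E.
  apply: eq_integral => x _; rewrite integral_cst// -[X in (_ * X)%E]/(N01 setT).
  by rewrite probability_setT mule1; refine (congr1 EFin _); rewrite !indicE.
have mS : measurable [set z : RT | A (t * z)].
  by rewrite -[X in measurable X]setTI; exact: mt.
by refine (etrans (integral_indic N01 measurableT mS) _); rewrite setIT.
Qed.

End gaussian_sum.

Lemma g_sigma_measurable_fun d d' (T : measurableType d) (T' : measurableType d')
    (C : set_system T) (X : T -> T') : C `<=` measurable ->
  measurable_fun setT (X : g_sigma_algebraType C -> T') -> measurable_fun setT X.
Proof.
move=> mC mX _ A mA.
by apply: (smallest_sub _ mC) (mX measurableT A mA); exact: sigma_algebra_measurable.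
Qed.

Section independent_integral.
Context d (T : measurableType d) (R : realType) (P : probability T R).
Local Notation RT := (measurableTypeR R).
Variables (C D : set_system T).
Hypotheses (mC : C `<=` measurable) (mD : D `<=` measurable).
Hypothesis CD : independent_classes P <<s C >> <<s D >>.
Variables (X Y : T -> RT) (Q1 Q2 : probability RT R).
Hypothesis mX : measurable_fun setT (X : g_sigma_algebraType C -> RT).
Hypothesis mY : measurable_fun setT (Y : g_sigma_algebraType D -> RT).
Hypothesis X_law : forall A, measurable A -> P (X @^-1` A) = Q1 A.
Hypothesis Y_law : forall A, measurable A -> P (Y @^-1` A) = Q2 A.

Lemma ge0_integral_indep (f : RT * RT -> \bar R) :
  measurable_fun setT f -> (forall z, 0 <= f z)%E ->
  (\int[P]_w f (X w, Y w) = \int[Q1]_x \int[Q2]_y f (x, y))%E.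
Proof.
apply: ge0_integral_joint_law.
- exact: (g_sigma_measurable_fun mC mX).
- exact: (g_sigma_measurable_fun mD mY).
move=> A B mA mB; rewrite CD ?X_law ?Y_law//.
- by have := mX measurableT mA; rewrite setTI.
- by have := mY measurableT mB; rewrite setTI.
Qed.

End independent_integral.

Section increment_sums.
Context {R : realType} d (E : measurableType d) (P : probability E R).
Variable br : gaussian_branching P.
Local Notation RT := (measurableTypeR R).
Local Notation N01 := (@normal_prob R 0 1).

Let mscal (s : R) : measurable_fun [set: RT] (fun z : RT => (s * z : RT)).
Proof. exact: (@measurable_funM _ _ R). Qed.

Let scalRV (s : R) : {RV N01 >-> RT} :=
  HB.pack (fun z : RT => (s * z : RT)) (isMeasurableFun.Build _ _ RT RT _ (mscal s)).

Lemma incr_sigma_sum (I : pred nat) n K L : (forall j, (K <= j < L)%N -> I j) ->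
  measurable_fun setT
    ((fun w => \sum_(K <= j < L) incr br n j w) :
      g_sigma_algebraType (incr_cylinder br I n) -> R).
Proof.
(* Terms outside [I] are replaced by [0], so that every summand is measurable for the small
   sigma-algebra. *)
move=> KI; rewrite (_ : (fun _ => _) = (fun w => \sum_(j <- index_iota K L)
    (if I j then incr br n j w else 0))); last first.
  by apply/funext => w; apply: eq_big_nat => j /KI ->.
apply: (@measurable_sum _ (g_sigma_algebraType (incr_cylinder br I n)) R setT _
  (index_iota K L) (fun j w => if I j then incr br n j w else 0)) => j.
have [Ij|nIj] := boolP (I j); last exact: measurable_cst.
exact: incr_sigma_incr.
Qed.

(** Stating the law as a scaled standard Gaussian covers the Dirac mass at [m = 0]. Each further
    increment is independent of the sum so far, and [gaussian_sum_law] updates the scale. *)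
Lemma incr_sum_law n K m (A : set R) : (K + m <= 2 ^ n)%N -> measurable A ->
  P [set w | A (\sum_(K <= j < K + m) incr br n j w)] =
  N01 [set z | A (Num.sqrt m%:R * z)].
Proof.
elim: m A => [|m IH] A Km mA.
  rewrite [in LHS](_ : [set _ | _] = [set _ | A 0]); last first.
    by apply/seteqP; split => w /=; rewrite addn0 big_geq.
  rewrite [in RHS](_ : [set _ | _] = [set _ | A 0]); last first.
    by apply/seteqP; split => w /=; rewrite sqrtr0 mul0r.
  have [A0|A0] := pselect (A 0).
    have AT U : [set _ : U | A 0] = setT by apply/seteqP; split.
    by rewrite !AT -[RHS]/(N01 setT) !probability_setT.
  have AF U : [set _ : U | A 0] = set0 by apply/seteqP; split.
  by rewrite !AF -[RHS]/(N01 set0) !measure0.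
pose S w := \sum_(K <= j < K + m) incr br n j w.
pose I := [pred j | (j == K + m)%N].
pose J := [pred j | (K <= j < K + m)%N].
have In k : I k -> (k < 2 ^ n)%N by move/eqP ->; rewrite addnS in Km.
have Jn k : J k -> (k < 2 ^ n)%N.
  by move/andP => [_ kK]; apply: leq_trans Km; rewrite addnS ltnW.
have IJ k : ~~ (I k && J k).
  by rewrite /I /J /=; case: eqP => //= ->; rewrite ltnn andbF.
have mf : measurable_fun setT (fun z : RT * RT => (\1_A (z.1 + z.2 : R))%:E : \bar R).
  apply/measurable_EFinP; apply: (measurableT_comp (@measurable_indic _ _ R setT A mA)).
  exact: (@measurable_funD _ _ R).
have f0 (z : RT * RT) : (0 <= (\1_A (z.1 + z.2 : R))%:E :> \bar R)%E by rewrite lee_fin.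
have mS : measurable_fun setT S.
  apply: g_sigma_measurable_fun (incr_sigma_sum (I := J) _) => //.
  exact: incr_cylinder_measurable.
have mX := measurable_incr br n (K + m)%N.
have mSX : measurable [set w | A (incr br n (K + m)%N w + S w)].
  rewrite -[X in measurable X]setTI.
  exact: (measurable_funD mX mS).
rewrite [in LHS](_ : [set _ | _] = [set w | A (incr br n (K + m)%N w + S w)]); last first.
  by apply/seteqP; split => w /=; rewrite addnS big_nat_recr ?leq_addr//= addrC.
transitivity (\int[P]_w (\1_A (incr br n (K + m)%N w + S w))%:E)%E.
  transitivity (\int[P]_w (\1_[set w | A (incr br n (K + m)%N w + S w)] w)%:E)%E.
    by rewrite integral_indic// setIT.
  by apply: eq_integral => w _; rewrite !indicE; congr ((_ : bool)%:R%:E); apply/idP/idP; rewrite !in_setE.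
have mcI : incr_cylinder br I n `<=` measurable by exact: incr_cylinder_measurable.
have mcJ : incr_cylinder br J n `<=` measurable by exact: incr_cylinder_measurable.
have := @ge0_integral_indep _ _ _ P _ _ mcI mcJ (incr_sigma_indep In Jn IJ)
  (incr br n (K + m)%N) S N01 (distribution N01 (scalRV (Num.sqrt m%:R))) _ _ _ _
  (fun z => (\1_A (z.1 + z.2 : R))%:E) mf f0.
rewrite /= => ->.
- transitivity (\int[N01]_y \int[N01]_x (\1_A (y + Num.sqrt m%:R * x)%R)%:E)%E.
    apply: eq_integral => y _.
    rewrite ge0_integral_distribution//.
    apply/measurable_EFinP; apply: (measurableT_comp (@measurable_indic _ _ R setT A mA)).
    exact: (@measurable_funD _ _ R).
  by rewrite gaussian_sum_law// sqr_sqrtr// -(natrD _ 1) add1n.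
- by apply: incr_sigma_incr => /=.
- by apply: incr_sigma_sum.
- by move=> B mB; apply: incr_law => //; exact: (In _ (eqxx _)).
- by move=> B mB; rewrite -[RHS]/(N01 [set z | B (Num.sqrt m%:R * z)]) -IH// ltnW// -addnS.
Qed.

(** Discrete form of the independence of an increment from the past: [G] is any observable of the
    increments before index [K]. *)
Lemma incr_sum_indep n K m (f : R -> R) (G : E -> R) : (K + m <= 2 ^ n)%N ->
  measurable_fun setT f -> (forall x, 0 <= f x) ->
  measurable_fun setT
    (G : g_sigma_algebraType (incr_cylinder br (fun j => (j < K)%N) n) -> R) ->
  (forall w, 0 <= G w) ->
  (\int[P]_w (f (\sum_(K <= j < K + m) incr br n j w) * G w)%:E =
   \int[N01]_z (f (Num.sqrt m%:R * z))%:E * \int[P]_w (G w)%:E)%E.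
Proof.
move=> Km mf f0 mG G0.
pose S w := \sum_(K <= j < K + m) incr br n j w.
pose I := (fun j => (j < K)%N).
pose J := [pred j | (K <= j < K + m)%N].
have In k : I k -> (k < 2 ^ n)%N.
  by move=> kK; apply: leq_trans kK _; apply: leq_trans Km; exact: leq_addr.
have Jn k : J k -> (k < 2 ^ n)%N.
  by move/andP => [_ kK]; apply: leq_trans Km.
have JI k : ~~ (J k && I k).
  apply/negP => /andP[/andP[h _] h2].
  by have := leq_ltn_trans h h2; rewrite ltnn.
have mcI : incr_cylinder br I n `<=` measurable by exact: incr_cylinder_measurable.
have mcJ : incr_cylinder br J n `<=` measurable by exact: incr_cylinder_measurable.
have mGE : measurable_fun setT (G : E -> RT) by exact: g_sigma_measurable_fun mG.
pose GRV : {RV P >-> RT} := HB.pack (G : E -> RT) (isMeasurableFun.Build _ _ E RT _ mGE).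
(* The transfer to the joint law requires nonnegativity on the whole plane, and [G] is nonnegative
   only along its values; hence the absolute value. *)
have mfG : measurable_fun setT (fun z : RT * RT => (f z.1 * `|z.2 : R|)%:E : \bar R).
  apply/measurable_EFinP; apply: measurable_funM.
    exact: (measurableT_comp mf).
  exact: (measurableT_comp (@normr_measurable R setT)).
have fG0 (z : RT * RT) : (0 <= (f z.1 * `|z.2 : R|)%:E :> \bar R)%E by rewrite lee_fin mulr_ge0.
have := @ge0_integral_indep _ _ _ P _ _ mcJ mcI (incr_sigma_indep Jn In JI)
  S G (distribution N01 (scalRV (Num.sqrt m%:R))) (distribution P GRV) _ _ _ _
  (fun z => (f z.1 * `|z.2 : R|)%:E) mfG fG0.
rewrite /= => H; transitivity (\int[P]_w (f (S w) * `|G w|)%:E)%E.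
  by apply: eq_integral => w _; rewrite ger0_norm.
rewrite H; last 4 first.
- by apply: incr_sigma_sum.
- exact: mG.
- by move=> B mB; exact: incr_sum_law.
- by [].
have mN : measurable_fun [set: RT] (fun y : RT => `|y : R|%:E).
  by apply/measurable_EFinP; exact: normr_measurable.
have mf' : measurable_fun [set: RT] (fun y : RT => (f y)%:E) by apply/measurable_EFinP.
transitivity (\int[distribution N01 (scalRV (Num.sqrt m%:R))]_x
    ((f x)%:E * \int[distribution P GRV]_y `|y : R|%:E))%E.
  apply: eq_integral => x _; rewrite -(@ge0_integralZl _ _ _ _ _ _ _ mN)//.
  by rewrite lee_fin.
rewrite ge0_integralZr//; [|by move=> x _; rewrite lee_fin|exact: integral_ge0].
refine (f_equal2 mule _ _).
  by refine (etrans (ge0_integral_distribution _ mf' _) _) => // y; rewrite lee_fin.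
refine (etrans (ge0_integral_distribution GRV mN _) _) => //.
by apply: eq_integral => w _; rewrite /= ger0_norm.
Qed.

End increment_sums.

(** * Convergence of dyadic paths *)

Section dyadic_path.
Context {R : realType}.
Variables (x : nat -> nat -> R) (N : nat).
Local Notation r := (9 / 10 : R).
Hypothesis x_split : forall n k, x n k = x n.+1 k.*2 + x n.+1 k.*2.+1.
Hypothesis x_small : forall n k, (N <= n)%N -> `|x n k| <= r ^+ n.

(** A step function instead of a linear interpolation, so that its increments in [t] are plain sums
    of the [y n j]. *)
Definition dyadic_sum (y : nat -> nat -> R) n (t : R) := \sum_(0 <= j < Num.truncn (2 ^+ n * t)) y n j.
Local Notation S := (dyadic_sum x).

Let rn0 n : 0 <= r ^+ n. Proof. by rewrite exprn_ge0//; lra. Qed.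

Let rn_small e : 0 < e -> exists2 n, (N <= n)%N & r ^+ n < e.
Proof.
move=> e0; have : r ^+ n @[n --> \oo] --> (0 : R).
  by apply: cvg_expr; rewrite ger0_norm; lra.
move/cvgrPdist_lt => /(_ e e0) [M _ HM]; exists (maxn M N); first exact: leq_maxr.
by have := HM _ (leq_maxl M N); rewrite sub0r normrN ger0_norm.
Qed.

Let sum_double n k : \sum_(0 <= j < k.*2) x n.+1 j = \sum_(0 <= j < k) x n j.
Proof.
elim: k => [|k IH]; first by rewrite !big_geq.
by rewrite doubleS !big_nat_recr//= IH (x_split n k) addrA.
Qed.

(** At a fixed time, halving the mesh keeps the last node or moves it one step further, so
    consecutive walks differ by at most one increment. *)
Let truncn_double (t : R) :
  Num.truncn (2 * t) = (Num.truncn t).*2 \/ Num.truncn (2 * t) = (Num.truncn t).*2.+1.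
Proof.
have [t0|t0] := leP 0 t; last first.
  have tn (s : R) : s < 0 -> Num.truncn s = 0%N.
    by move=> s0; apply/truncn0Pn; rewrite -ltNge; lra.
  by left; rewrite !tn//; lra.
have /andP[] := truncn_itv t0; set k := Num.truncn t => kt tk.
rewrite -[k.+1]addn1 natrD in tk.
have [h|h] := ltP (2 * t) (k.*2.+1)%:R.
  left; apply: truncn_def; rewrite h andbT -muln2 natrM; lra.
right; apply: truncn_def; rewrite h/=.
by rewrite -[k.*2.+2]/(k.+1.*2) -muln2 natrM -[k.+1]addn1 natrD; lra.
Qed.

Let dyadic_sum_step n t : (N <= n.+1)%N -> `|S n.+1 t - S n t| <= r ^+ n.+1.
Proof.
move=> Nn; rewrite /dyadic_sum exprS -mulrA.
have [->|->] := truncn_double (2 ^+ n * t).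
  by rewrite sum_double subrr normr0.
by rewrite big_nat_recr//= sum_double addrAC subrr add0r x_small.
Qed.

(** A geometric sum from [n + 1] to [n + m]; the constant is [r / (1 - r) = 9]. *)
Let dyadic_sum_cauchy n m t : (N <= n)%N ->
  `|S (n + m)%N t - S n t| <= 9 * r ^+ n - 9 * r ^+ (n + m).
Proof.
move=> Nn; elim: m => [|m IH]; first by rewrite addn0 !subrr normr0.
have h := @dyadic_sum_step (n + m)%N t (leq_trans Nn (leqW (leq_addr _ _))).
rewrite addnS exprS in h *.
rewrite (_ : _ - _ = (S (n + m).+1 t - S (n + m)%N t) + (S (n + m)%N t - S n t)); last by ring.
by apply: le_trans (ler_normD _ _) _; lra.
Qed.

Lemma is_cvg_dyadic_sum t : cvgn (S ^~ t).
Proof.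
apply/cauchy_cvgP/cauchy_exP => e e0.
have [n Nn rn] := rn_small (e := e / 10) ltac:(lra).
exists (S n t), n => // m /= nm; rewrite /ball/= -(subnKC nm) distrC.
apply: le_lt_trans (dyadic_sum_cauchy _ _ Nn) _.
by have := rn0 (n + (m - n))%N; lra.
Qed.

Lemma dyadic_sum_lim n t : (N <= n)%N -> `|limn (S ^~ t) - S n t| <= 9 * r ^+ n.
Proof.
move=> Nn.
have h : `|S k t - S n t| @[k --> \oo] --> `|limn (S ^~ t) - S n t|.
  by apply: cvg_norm; apply: cvgB; [exact: is_cvg_dyadic_sum|exact: cvg_cst].
rewrite -(cvg_lim _ h)//; apply: limr_le; first exact: cvgP h.
exists n => // k /= nk; rewrite -(subnKC nk).
by apply: le_trans (dyadic_sum_cauchy _ _ Nn) _; rewrite lerBlDr lerDl mulr_ge0.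
Qed.

Let dyadic_sum_near n s t : (N <= n)%N -> s <= t -> t - s < (2 ^+ n)^-1 ->
  `|S n t - S n s| <= r ^+ n.
Proof.
move=> Nn st ts.
have h2 : 0 < 2 ^+ n :> R by rewrite exprn_gt0.
have h : 2 ^+ n * t < 2 ^+ n * s + 1.
  by move: ts; rewrite -[_^-1]mul1r ltr_pdivlMr// mulrBl ![_ * 2 ^+ n]mulrC; lra.
have le : (Num.truncn (2 ^+ n * s) <= Num.truncn (2 ^+ n * t))%N.
  by apply: le_truncn; rewrite ler_pM2l.
have : (Num.truncn (2 ^+ n * t) <= (Num.truncn (2 ^+ n * s)).+1)%N.
  rewrite truncn_le_nat -[X in _ < X]natr1.
  by apply: lt_trans h _; rewrite ltrD2r truncnS_gt.
rewrite leq_eqVlt ltnS => /orP[/eqP E|E].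
  by rewrite /dyadic_sum E big_nat_recr//= addrAC subrr add0r x_small.
by rewrite /dyadic_sum (@anti_leq _ _ (introT andP (conj E le))) subrr normr0.
Qed.

Lemma continuous_dyadic_lim : continuous (fun t => limn (S ^~ t)).
Proof.
move=> t; apply/cvgrPdist_lt => e e0.
(* Two approximation errors of [9 * r ^ n] and one oscillation of [r ^ n] add up to [19 * r ^ n]. *)
have [n Nn rn] := rn_small (e := e / 20) ltac:(lra).
have h2 : 0 < (2 ^+ n)^-1 :> R by rewrite invr_gt0 exprn_gt0.
near=> s.
have st : `|t - s| < (2 ^+ n)^-1.
  by near: s; exact: (@cvgr_dist_lt _ _ _ _ _ id).
have := dyadic_sum_lim t Nn; have := dyadic_sum_lim s Nn.
have : `|S n t - S n s| <= r ^+ n.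
  have [ts|/ltW ts] := leP s t; last rewrite distrC.
    by apply: dyadic_sum_near => //; rewrite ltr_norml in st; lra.
  by apply: dyadic_sum_near => //; rewrite ltr_norml in st; lra.
rewrite !ler_norml ltr_norml; lra.
Unshelve. all: by end_near. Qed.

End dyadic_path.

(** * Brownian motion *)

Section normal_tail.
Context {R : realType}.
Local Notation mu := (@lebesgue_measure R).
Local Notation N01 := (@normal_prob R 0 1).

(** Comparison with a wider Gaussian avoids computing a fourth moment. The ratio of the exponentials
    is [exp (- 2 y)] with [y = 3 / 16 * z ^ 2], and [y ^ 2 <= exp (2 y)]. *)
Let normal_pdf_le : exists2 C : R, 0 <= C &
  forall z, z ^+ 4 * normal_pdf 0 1 z <= C * normal_pdf 0 2 z.
Proof.
have n2 : (2 : R) != 0 by [].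
exists ((16 / 3) ^+ 2 * normal_peak 1 / normal_peak 2).
  by apply: divr_ge0; [apply: mulr_ge0; first exact: sqr_ge0|]; exact: normal_peak_ge0.
move=> z; rewrite (normal_pdfE _ (oner_neq0 R)) (normal_pdfE _ n2) /=.
have k2 : normal_peak (2 : R) != 0 by rewrite gt_eqF// normal_peak_gt0.
rewrite [leRHS]mulrA divfK// [leLHS]mulrCA -[leRHS]mulrA [leRHS]mulrCA.
rewrite ler_wpM2l ?normal_peak_ge0// /normal_fun !subr0.
have -> : - z ^+ 2 / (1 ^+ 2 *+ 2) = - (3 / 8 * z ^+ 2) + - z ^+ 2 / (2 ^+ 2 *+ 2) :> R by field.
rewrite expRD mulrA ler_wpM2r ?expR_ge0// expRN ler_pdivrMr ?expR_gt0//.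
pose y := 3 / 16 * z ^+ 2.
have y0 : 0 <= y by rewrite mulr_ge0 ?sqr_ge0.
have -> : 3 / 8 * z ^+ 2 = y + y by rewrite /y; field.
have -> : z ^+ 4 = (16 / 3) ^+ 2 * y ^+ 2 by rewrite /y; field.
rewrite ler_wpM2l ?sqr_ge0// expRD -expr2 lerXn2r ?nnegrE ?expR_ge0//.
by apply: le_trans (expR_ge1Dx y); rewrite lerDr.
Qed.

(** Markov's inequality for the fourth power; the dominating Gaussian has total mass one. *)
Lemma normal_tail : exists2 C : R, 0 <= C &
  forall c, 0 < c -> (N01 [set z | (c < `|z|)%R] <= (C / c ^+ 4)%:E)%E.
Proof.
have [C C0 HC] := normal_pdf_le; exists C => // c c0.
have mA : measurable ([set z | c < `|z|] : set (measurableTypeR R)).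
  rewrite -[X in measurable X]setTI.
  have -> : [set z : R | c < `|z|] = (@Num.norm _ R) @^-1` `]c, +oo[%classic.
    by apply/seteqP; split => x /=; rewrite in_itv/= andbT.
  exact: normr_measurable.
have c4 : 0 < c ^+ 4 by rewrite exprn_gt0.
have m1 := @measurable_normal_pdf R 0 1; have m2 := @measurable_normal_pdf R 0 2.
apply: (@le_trans _ _ (\int[mu]_(z in [set z | (c < `|z|)%R]) ((C / c ^+ 4)%:E * (normal_pdf 0 2 z)%:E)))%E.
  apply: ge0_le_integral => //.
  - by move=> z _; rewrite lee_fin normal_pdf_ge0.
  - by apply/measurable_EFinP; exact: measurable_funTS m1.
  - apply: emeasurable_funM; first exact: measurable_cst.
    by apply/measurable_EFinP; exact: measurable_funTS m2.
  - move=> z /= cz; rewrite -EFinM lee_fin mulrAC ler_pdivlMr//.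
    apply: le_trans (HC z); rewrite mulrC ler_wpM2r ?normal_pdf_ge0//.
    rewrite -[leRHS]ger0_norm; last by rewrite exprn_even_ge0.
    by rewrite normrX lerXn2r ?nnegrE// ltW.
rewrite ge0_integralZl//.
- have Cc0 : (0 <= (C / c ^+ 4)%:E :> \bar R)%E by rewrite lee_fin divr_ge0// ltW.
  rewrite -[leRHS]mule1; apply: (lee_wpmul2l Cc0).
  rewrite -[leLHS]/(normal_prob 0 2 [set z : R | (c < `|z|)%R]).
  exact: probability_le1.
- by apply/measurable_EFinP; exact: measurable_funTS m2.
- by move=> z _; rewrite lee_fin normal_pdf_ge0.
- by rewrite lee_fin divr_ge0// ltW.
Qed.

End normal_tail.

Lemma bounded_cvg_Rintegral d (T : measurableType d) (R : realType)
    (P : probability T R) (h : nat -> T -> R) (g : T -> R) :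
  (forall n, measurable_fun setT (h n)) -> measurable_fun setT g ->
  (forall n w, 0 <= h n w <= 1) -> {ae P, forall w, h n w @[n --> \oo] --> g w} ->
  \int[P]_w h n w @[n --> \oo] --> \int[P]_w g w.
Proof.
move=> mh mg h01 hg.
have mh' n : measurable_fun setT (EFin \o h n) by apply/measurable_EFinP.
have mg' : measurable_fun setT (EFin \o g) by apply/measurable_EFinP.
have hg' : {ae P, forall w, setT w -> (EFin \o h n) w @[n --> \oo] --> (EFin \o g) w}.
  by apply: filterS hg => w hgw _; apply/fine_cvgP; split; [exact: nearW|exact: hgw].
have i1 : P.-integrable setT (cst 1%E) by exact: finite_measure_integrable_cst.
have h1 : {ae P, forall w n, setT w -> (`|(EFin \o h n) w| <= cst 1 w)%E}.
  apply: aeW => w n _ /=; have /andP[h0 h1] := h01 n w.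
  by rewrite lee_fin ger0_norm.
have [ig _ H] := dominated_convergence measurableT mh' mg' hg' i1 h1.
apply: fine_cvg; rewrite fineK//; exact: integrable_fin_num.
Qed.

(** * Borel-Cantelli and construction of the paths *)

Section brownian_motion.
Context {R : realType} d (E : measurableType d) (P : probability E R).
Variable br : gaussian_branching P.
Local Notation RT := (measurableTypeR R).
Local Notation N01 := (@normal_prob R 0 1).
Local Notation r := (9 / 10 : R).
(* Any 0 < r < 1 with 2 r^4 > 1 would do: by the fourth moment bound the event
   [|incr n k| > (sqrt 2 * r) ^ n for some k] has probability O(rho ^ n), where
   rho = 1 / (2 r^4) < 1. *)
Local Notation rho := ((10 / 9) ^+ 4 / 2 : R).
Local Notation sqrt2 := (Num.sqrt 2 : R).

Let rho01 : 0 < rho < 1. Proof. by rewrite !exprS expr0; lra. Qed.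
Let sqrt2_gt0 : 0 < sqrt2. Proof. by rewrite sqrtr_gt0. Qed.
Let sqrt2_sqr : sqrt2 ^+ 2 = 2. Proof. by rewrite sqr_sqrtr. Qed.
Let sqrt2n_gt0 n : 0 < sqrt2 ^+ n. Proof. by rewrite exprn_gt0. Qed.
Let threshold_gt0 n : 0 < (sqrt2 * r) ^+ n.
Proof. by rewrite exprn_gt0// mulr_gt0//; lra. Qed.

Definition dyadic_incr w n k := incr br n k w / sqrt2 ^+ n.

Let dyadic_incr_split w n k :
  dyadic_incr w n k = dyadic_incr w n.+1 k.*2 + dyadic_incr w n.+1 k.*2.+1.
Proof.
rewrite /dyadic_incr -mulrDl incr_split exprS invfM mulrACA.
by rewrite mulfV ?mul1r// gt_eqF.
Qed.

Let large n k := [set w | (sqrt2 * r) ^+ n < `|incr br n k w|].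

Let measurable_large n k : measurable (large n k).
Proof.
rewrite (_ : large n k = setT `&` (fun w => `|incr br n k w|) @^-1` `](sqrt2 * r) ^+ n, +oo[%classic).
  have m : measurable_fun setT (fun w => `|incr br n k w|).
    by apply: measurableT_comp; [exact: normr_measurable|exact: measurable_incr].
  exact: m.
by rewrite setTI; apply/seteqP; split => w /=; rewrite in_itv/= andbT.
Qed.

Let bad n := \big[setU/set0]_(k < 2 ^ n) large n k.

Let measurable_bad n : measurable (bad n).
Proof. exact: bigsetU_measurable. Qed.

(** A union bound over [2 ^ n] indices: [2 ^ n * C / (sqrt2 * r) ^ (4 n)] equals [C * rho ^ n]. *)
Let bad_prob : exists2 C : R, 0 <= C &
  forall n, (P (bad n) <= (geometric C rho n)%:E)%E.
Proof.
have [C C0 HC] := @normal_tail R; exists C => // n.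
apply: le_trans (Boole_inequality _ _) _ => //.
apply: (@le_trans _ _ (\sum_(k < 2 ^ n) (C / ((sqrt2 * r) ^+ n) ^+ 4)%:E)%E).
  apply: lee_sum => k _; apply: le_trans (HC _ (threshold_gt0 n)).
  rewrite -(@incr_law _ _ _ _ br n k)//.
  rewrite -[X in measurable X]setTI.
  have -> : [set z : R | (sqrt2 * r) ^+ n < `|z|] =
      (@Num.norm _ R) @^-1` `](sqrt2 * r) ^+ n, +oo[%classic.
    by apply/seteqP; split => z /=; rewrite in_itv/= andbT.
  exact: normr_measurable.
rewrite sumEFin sumr_const card_ord lee_fin -[_ *+ (2 ^ n)%N]mulr_natr natrX.
rewrite -exprM mulnC exprM -mulrA -exprVn -exprMn /=.
have rhoE : ((sqrt2 * r) ^+ 4)^-1 * 2 = rho.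
  by rewrite exprMn (exprM sqrt2 2 2) sqrt2_sqr; field.
by rewrite rhoE.
Qed.

Definition small_incr := ~` lim_sup_set bad.

Let measurable_small_incr : measurable small_incr.
Proof.
apply: measurableC; apply: bigcapT_measurable => n.
by apply: bigcup_measurable => k _.
Qed.

Let P_lim_sup_bad : P (lim_sup_set bad) = 0%E.
Proof.
apply: lim_sup_set_cvg0 => //.
have [C C0 HC] := bad_prob.
apply: (@le_lt_trans _ _ (C * (1 - rho)^-1)%:E); last exact: ltry.
apply: lime_le; first by apply: is_cvg_nneseries.
apply: nearW => n.
apply: (@le_trans _ _ (\sum_(0 <= i < n) (geometric C rho i)%:E)%E).
  by apply: lee_sum => i _; exact: HC.
rewrite sumEFin lee_fin; have /andP[rho0 rho1] := rho01.
by apply: geometric_le_lim => //; rewrite ger0_norm// ltW.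
Qed.

Let small_incrP w : small_incr w ->
  exists N, forall n k, (N <= n)%N -> `|dyadic_incr w n k| <= r ^+ n.
Proof.
rewrite /small_incr /lim_sup_set setC_bigcap => -[N _ Nw]; exists N => n k Nn.
rewrite /dyadic_incr normrM normfV (gtr0_norm (sqrt2n_gt0 n)) ler_pdivrMr// mulrC -exprMn.
have [kn|kn] := ltnP k (2 ^ n)%N; last by rewrite incr_ge// normr0 ltW.
rewrite leNgt; apply/negP => h; apply: Nw; exists n => //.
by rewrite /bad -bigcup_mkord; exists k.
Qed.

(** The value [0] off [small_incr] makes every path continuous, and not just almost every one. *)
Definition brownian (t : R) (w : E) : R :=
  if w \in small_incr then limn (fun n => dyadic_sum (dyadic_incr w) n t) else 0.

Lemma continuous_brownian w : continuous (brownian ^~ w).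
Proof.
have [sw|sw] := boolP (w \in small_incr); last first.
  rewrite (_ : brownian ^~ w = cst 0); first by move=> t; exact: cvg_cst.
  by apply/funext => t; rewrite /brownian (negbTE sw).
rewrite (_ : brownian ^~ w = fun t => limn (fun n => dyadic_sum (dyadic_incr w) n t)).
  move: sw; rewrite inE => /small_incrP[N HN].
  exact: (continuous_dyadic_lim (dyadic_incr_split w) HN).
by apply/funext => t; rewrite /brownian sw.
Qed.

Lemma brownian_cvg t w : small_incr w ->
  dyadic_sum (dyadic_incr w) n t @[n --> \oo] --> brownian t w.
Proof.
move=> sw; rewrite /brownian mem_set//; have [N HN] := small_incrP sw.
exact: (is_cvg_dyadic_sum (dyadic_incr_split w) HN).
Qed.

Lemma ae_small_incr : {ae P, forall w, small_incr w}.
Proof.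
exists (lim_sup_set bad); split => //.
  by rewrite -[lim_sup_set bad]setCK; exact: measurableC.
by rewrite /small_incr setCK.
Qed.

Lemma measurable_dyadic_sum n t :
  measurable_fun setT (fun w => dyadic_sum (dyadic_incr w) n t).
Proof.
rewrite /dyadic_sum; apply: measurable_sum => j.
by apply: measurable_funM => //; exact: measurable_incr.
Qed.

Lemma measurable_brownian t : measurable_fun setT (brownian t).
Proof.
apply: (@measurable_fun_cvg _ _ _ _ (fun n w =>
  if w \in small_incr then dyadic_sum (dyadic_incr w) n t else 0)).
  move=> n; apply: measurable_fun_ifT => //.
    by apply: (measurable_fun_bool true); rewrite setTI;
      rewrite (_ : _ @^-1` _ = small_incr)//; apply/seteqP;
      split => w /= h; [exact: set_mem|exact: mem_set].
  exact: measurable_dyadic_sum.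
move=> w _; rewrite /brownian; case: ifPn => [|_]; last exact: cvg_cst.
by rewrite inE => sw; have := @brownian_cvg t w sw; rewrite /brownian mem_set.
Qed.

Lemma brownian0 w : brownian 0 w = 0.
Proof.
rewrite /brownian; case: ifP => // _.
rewrite (_ : (fun _ => _) = cst 0) ?lim_cst//.
by apply/funext => n; rewrite /dyadic_sum mulr0 truncn0 big_geq.
Qed.

End brownian_motion.

Lemma truncn_dyadic_cvg (R : realType) (t : R) : 0 <= t ->
  (Num.truncn (2 ^+ n * t))%:R / 2 ^+ n @[n --> \oo] --> t.
Proof.
move=> t0; apply/cvgrPdist_le => e e0.
have : 2^-1 ^+ n @[n --> \oo] --> (0 : R) by apply: cvg_expr; rewrite ger0_norm; lra.
move/cvgrPdist_lt => /(_ e e0) [M _ HM]; exists M => // n /= Mn.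
have := HM n Mn; rewrite sub0r normrN ger0_norm ?exprn_ge0// exprVn.
have p0 : 0 < 2 ^+ n :> R by rewrite exprn_gt0.
have /andP[] := truncn_itv (mulr_ge0 (ltW p0) t0).
set k := Num.truncn _; rewrite -[k.+1]addn1 natrD => h1 h2 h3.
have h4 : k%:R / 2 ^+ n <= t by rewrite ler_pdivrMr// mulrC.
have h5 : t <= (k%:R + 1) / 2 ^+ n by rewrite ler_pdivlMr// mulrC ltW.
by rewrite mulrDl mul1r in h5; rewrite ger0_norm ?subr_ge0//; lra.
Qed.

Lemma cvg_prod_seq (R : realType) (I : Type) (ts : seq I) (h : nat -> I -> R) (g : I -> R) :
  (forall i, h n i @[n --> \oo] --> g i) ->
  \prod_(i <- ts) h n i @[n --> \oo] --> \prod_(i <- ts) g i.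
Proof.
move=> hg; elim: ts => [|i ts IH].
  by rewrite big_nil; under eq_fun do rewrite big_nil; exact: cvg_cst.
by rewrite big_cons; under eq_fun do rewrite big_cons; exact: cvgM.
Qed.

(** * Passage from dyadic walks to their limit *)

Section brownian_increments.
Context {R : realType} d (E : measurableType d) (P : probability E R).
Variable br : gaussian_branching P.
Local Notation RT := (measurableTypeR R).
Local Notation N01 := (@normal_prob R 0 1).
Local Notation B := (brownian br).
Local Notation D n t w := (dyadic_sum (dyadic_incr br w) n t).

Let prod01 (I : Type) (ts : seq I) (h : I -> R) :
  (forall i, 0 <= h i <= 1) -> 0 <= \prod_(i <- ts) h i <= 1.
Proof.
move=> h01; elim: ts => [|i ts /andP[IH0 IH1]]; first by rewrite big_nil ler01 lexx.
have /andP[h0 h1] := h01 i.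
by rewrite big_cons mulr_ge0//= mulr_ile1.
Qed.

Let dyadic_incrB n s t w : 0 <= s -> s <= t ->
  D n t w - D n s w = (\sum_(Num.truncn (2 ^+ n * s) <= j < Num.truncn (2 ^+ n * t))
    incr br n j w) / Num.sqrt 2 ^+ n.
Proof.
move=> s0 st; rewrite /dyadic_sum.
have le : (Num.truncn (2 ^+ n * s) <= Num.truncn (2 ^+ n * t))%N.
  by apply: le_truncn; rewrite ler_pM2l// exprn_gt0.
rewrite (big_cat_nat (leq0n _) le)/=.
by rewrite addrAC subrr add0r /dyadic_incr mulr_suml.
Qed.

Let measurable_continuous (f : R -> R) : continuous f -> measurable_fun setT f.
Proof. exact: continuous_measurable_fun. Qed.

(** The walks satisfy this identity exactly at each level, with a rounded variance. Continuity of
    the test functions lets pointwise convergence through, and their bounds allow dominated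
    convergence. A pair in [ts] is a time and the parameter of its test function. *)
Lemma brownian_incr_indep_continuous (f : R -> R) (g : R -> R -> R)
    (ts : seq (R * R)) (s t : R) :
  0 <= s -> s <= t -> t <= 1 ->
  continuous f -> (forall a, continuous (g a)) ->
  (forall y, 0 <= f y <= 1) -> (forall a y, 0 <= g a y <= 1) ->
  (forall p, p \in ts -> 0 <= p.1 <= s) ->
  \int[P]_w (f (B t w - B s w) * \prod_(p <- ts) g p.2 (B p.1 w)) =
  \int[N01]_z f (Num.sqrt (t - s) * z) * \int[P]_w (\prod_(p <- ts) g p.2 (B p.1 w)).
Proof.
move=> s0 st t1 cf cg f01 g01 ts_s.
pose K n := Num.truncn (2 ^+ n * s); pose L n := Num.truncn (2 ^+ n * t).
have mf := measurable_continuous cf.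
have mg a := measurable_continuous (cg a).
have p0 n : 0 < 2 ^+ n :> R by rewrite exprn_gt0.
have KL n : (K n <= L n)%N by apply: le_truncn; rewrite ler_pM2l.
have L2 n : (L n <= 2 ^ n)%N.
  rewrite truncn_le_nat (@le_lt_trans _ _ (2 ^+ n))//.
    by rewrite ler_piMr// ltW.
  by rewrite -[X in _ < X]natr1 natrX ltrDl.
have KLn n : (K n + (L n - K n) <= 2 ^ n)%N by rewrite subnKC.
(* The standard deviation of the walk between the roundings of [s] and [t]; its square tends to
   [t - s]. *)
pose c n : R := Num.sqrt (L n - K n)%:R / Num.sqrt 2 ^+ n.
have c_cvg : c n @[n --> \oo] --> Num.sqrt (t - s).
  have -> : c = (fun n => Num.sqrt ((L n)%:R / 2 ^+ n - (K n)%:R / 2 ^+ n)).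
    apply/funext => n; rewrite /c -mulrBl -natrB// sqrtrM//; congr (_ * _).
    rewrite (sqrtrV (ltW (p0 n))); congr (_^-1).
    by elim: n => [|n IH]; rewrite ?expr0 ?sqrtr1// !exprS sqrtrM// IH.
  apply: continuous_cvg; first exact: sqrt_continuous.
  by apply: cvgB; apply: truncn_dyadic_cvg => //; apply: le_trans st.
pose G n w := \prod_(p <- ts) g p.2 (D n p.1 w).
(* All times in [ts] are at most [s], so only increments of index below [K n] occur. *)
have mG n : measurable_fun setT
    (G n : g_sigma_algebraType (incr_cylinder br (fun j => (j < K n)%N) n) -> R).
  apply: (@measurable_prod _ (g_sigma_algebraType (incr_cylinder br (fun j => (j < K n)%N) n))
    R setT _ ts (fun p w => g p.2 (D n p.1 w))) => p pts.
  apply: (measurableT_comp (mg p.2)); rewrite /dyadic_sum /dyadic_incr.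
  rewrite (_ : (fun _ => _) = (fun w => (\sum_(0 <= j < Num.truncn (2 ^+ n * p.1))
      incr br n j w) * (Num.sqrt 2 ^+ n)^-1)); last first.
    by apply/funext => w; rewrite mulr_suml.
  apply: measurable_funM; last exact: measurable_cst.
  apply: incr_sigma_sum => j /andP[_ jp]; apply: leq_trans jp _.
  apply: le_truncn; rewrite ler_pM2l//.
  by have /andP[] := ts_s p pts.
have mGE n : measurable_fun setT (G n).
  by apply: g_sigma_measurable_fun (mG n); exact: incr_cylinder_measurable.
have G01 n w : 0 <= G n w <= 1 by exact: prod01.
pose GB w := \prod_(p <- ts) g p.2 (B p.1 w).
have mGB : measurable_fun setT GB.
  apply: measurable_prod => p _; apply: measurableT_comp => //.
  exact: measurable_brownian.
have G_cvg w : small_incr br w -> G n w @[n --> \oo] --> GB w.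
  move=> sw; apply: cvg_prod_seq => p.
  by apply: continuous_cvg; [exact: cg|exact: brownian_cvg].
have intG : \int[P]_w G n w @[n --> \oo] --> \int[P]_w GB w.
  apply: bounded_cvg_Rintegral => //.
  exact: filterS (ae_small_incr br).
have intf : \int[N01]_z f (c n * z) @[n --> \oo] --> \int[N01]_z f (Num.sqrt (t - s) * z).
  apply: (bounded_cvg_Rintegral (P := N01)) => //.
  - by move=> n; apply: (measurableT_comp mf); exact: (@measurable_funM _ _ R).
  - by apply: (measurableT_comp mf); exact: (@measurable_funM _ _ R).
  - apply: aeW => z; apply: continuous_cvg; first exact: cf.
    by apply: cvgMl; exact: c_cvg.
have intfG : \int[P]_w (f (D n t w - D n s w) * G n w) @[n --> \oo] -->
    \int[P]_w (f (B t w - B s w) * GB w).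
  apply: bounded_cvg_Rintegral => //.
  - move=> n; apply: measurable_funM => //; apply: (measurableT_comp mf).
    by apply: measurable_funB; exact: measurable_dyadic_sum.
  - apply: measurable_funM => //; apply: (measurableT_comp mf).
    by apply: measurable_funB; exact: measurable_brownian.
  - move=> n w; have /andP[? ?] := G01 n w; have /andP[? ?] := f01 (D n t w - D n s w).
    by rewrite mulr_ge0//= mulr_ile1.
  - apply: filterS (ae_small_incr br) => w sw; apply: cvgM; last exact: G_cvg.
    apply: continuous_cvg; first exact: cf.
    by apply: cvgB; exact: brownian_cvg.
(* Both sides are now limits of the same sequence, by the discrete identity at level [n]. *)
apply: (cvg_unique _ intfG) => //=.
rewrite (_ : (fun n => _) = (fun n => \int[N01]_z f (c n * z) * \int[P]_w G n w)).
  exact: cvgM.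
apply/funext => n; rewrite /Rintegral -fineM; last 2 first.
- apply: integrable_fin_num => //; apply: (@integrable_unit_interval R _ RT N01 (fun z => f (c n * z))) => //.
  by apply: (measurableT_comp mf); exact: (@measurable_funM _ _ R).
- by apply: integrable_fin_num => //; exact: integrable_unit_interval.
congr fine.
have mfc : measurable_fun setT (fun y : R => f (y / Num.sqrt 2 ^+ n)).
  by apply: (measurableT_comp mf); exact: measurable_funM.
have f0 y : 0 <= f (y / Num.sqrt 2 ^+ n) by case/andP: (f01 (y / Num.sqrt 2 ^+ n)).
have G0 w : 0 <= G n w by case/andP: (G01 n w).
have := incr_sum_indep (KLn n) mfc f0 (mG n) G0; rewrite subnKC// => H.
transitivity (\int[P]_w (f ((\sum_(K n <= j < L n) incr br n j w) / Num.sqrt 2 ^+ n) * G n w)%:E)%E.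
  by apply: eq_integral => w _; rewrite (dyadic_incrB _ _ s0 st).
rewrite H; refine (f_equal2 mule _ _) => //.
by apply: eq_integral => z _; rewrite /c mulrAC.
Qed.

End brownian_increments.

(** * Law and independence of the increments *)

Section ramp.
Context {R : realType}.

(** A continuous approximation of the indicator of an open upper ray; it vanishes at [a] itself, so
    the limit is the open ray and not the closed one. *)
Definition ramp (k : nat) (a y : R) : R := Num.min 1 (Num.max 0 (k%:R * (y - a))).

Lemma ramp01 k a y : 0 <= ramp k a y <= 1.
Proof. by rewrite /ramp le_min ler01 le_max lexx ge_min lexx. Qed.

Lemma continuous_ramp k a : continuous (ramp k a).
Proof.
have h : continuous (fun y : R => k%:R * (y - a)).
  by move=> y; apply: cvgMr; apply: cvgB; [exact: cvg_id|exact: cvg_cst].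
move=> y; apply: (@continuous_min R R (cst 1) (fun y => Num.max 0 (k%:R * (y - a)))).
  exact: cst_continuous.
apply: (@continuous_max R R (cst 0) (fun y => k%:R * (y - a))).
  exact: cst_continuous.
exact: h.
Qed.

Lemma ramp_cvg a y : ramp k a y @[k --> \oo] --> ((a < y)%R%:R : R).
Proof.
have [ay|ya] := ltP a y; last first.
  apply: cvg_near_cst; apply: nearW => k; apply/eqP; rewrite /ramp.
  by rewrite (max_idPl _) ?(min_idPr _)// mulr_ge0_le0// subr_le0.
apply: cvg_near_cst; exists (Num.truncn (y - a)^-1).+1 => // k /= hk.
apply/eqP; rewrite /ramp (min_idPl _)// le_max; apply/orP; right.
rewrite -ler_pdivrMr ?subr_gt0// mul1r ltW// (lt_le_trans (truncnS_gt _))//.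
by rewrite ler_nat.
Qed.

End ramp.

Section sigma_rv.
Context d (T : measurableType d) (R : realType).

Lemma sigma_rv_sub (X : T -> R) (C : set_system T) :
  (forall a, <<s C >> [set w | a < X w]) -> sigma_rv X `<=` <<s C >>.
Proof.
move=> CX _ [A mA <-].
suff mX : measurable_fun setT (X : g_sigma_algebraType C -> R) by exact: mX.
apply: (measurability (@RGenOInfty.G R)); first exact: RGenOInfty.measurableE.
move=> _ [_ [a ->] <-]; rewrite setTI.
rewrite (_ : _ @^-1` _ = [set w | a < X w]); first exact: CX.
by apply/seteqP; split => w /=; rewrite in_itv/= andbT.
Qed.

Lemma sigma_rv_comp (X : T -> R) (g : R -> R) : measurable_fun setT g ->
  sigma_rv (g \o X) `<=` sigma_rv X.
Proof.
move=> mg _ [A mA <-]; exists (g @^-1` A) => //.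
by rewrite -[X in measurable X]setTI; exact: mg.
Qed.

End sigma_rv.

Section brownian_law.
Context {R : realType} d (E : measurableType d) (P : probability E R).
Variable br : gaussian_branching P.
Local Notation RT := (measurableTypeR R).
Local Notation N01 := (@normal_prob R 0 1).
Local Notation B := (brownian br).

(** The pairs are times and thresholds. Concatenating lists intersects events, which makes these
    events a pi-system. *)
Let above (ts : seq (R * R)) := [set w | all (fun p => p.2 < B p.1 w) ts].

Let measurable_incrB s t : measurable_fun setT (fun w => B t w - B s w).
Proof. by apply: measurable_funB; exact: measurable_brownian. Qed.

Let measurable_gt d' (T : measurableType d') (f : T -> R) a :
  measurable_fun setT f -> measurable [set w | a < f w].
Proof.
move=> mf; have -> : [set w | a < f w] = setT `&` f @^-1` `]a, +oo[%classic.
  by rewrite setTI; apply/seteqP; split => w /=; rewrite in_itv/= andbT.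
exact: mf.
Qed.

Let measurable_above ts : measurable (above ts).
Proof.
elim: ts => [|p ts IH].
  by rewrite (_ : above _ = setT)//; apply/seteqP; split.
rewrite (_ : above _ = [set w | p.2 < B p.1 w] `&` above ts).
  by apply: measurableI => //; apply: measurable_gt; exact: measurable_brownian.
by apply/seteqP; split => w /=; rewrite /above/= => /andP.
Qed.

Let Rintegral_setE d' (T : measurableType d') (Q : probability T R) (A : set T) :
  measurable A -> \int[Q]_w \1_A w = fine (Q A).
Proof. by move=> mA; rewrite /Rintegral integral_indic// setIT. Qed.

(** The identity for continuous test functions is applied to ramps, whose products converge to the
    indicators of the events. *)
Let brownian_incr_indep_above (ts : seq (R * R)) (s t a : R) :
  0 <= s -> s <= t -> t <= 1 -> (forall p, p \in ts -> 0 <= p.1 <= s) ->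
  P ([set w | a < B t w - B s w] `&` above ts) =
  (N01 [set z | (a < Num.sqrt (t - s) * z)%R] * P (above ts))%E.
Proof.
move=> s0 st t1 ts_s.
have mS := measurable_gt a (measurable_incrB s t).
have mN : measurable ([set z | a < Num.sqrt (t - s) * z] : set RT).
  by apply: (@measurable_gt _ RT); exact: (@measurable_funM _ _ R).
have mA := measurable_above ts.
pose G k w := \prod_(p <- ts) ramp k p.2 (B p.1 w).
have mr k y : measurable_fun setT (@ramp R k y).
  by apply: continuous_measurable_fun; exact: continuous_ramp.
have mG k : measurable_fun setT (G k).
  apply: measurable_prod => p _; apply: measurableT_comp => //.
  exact: measurable_brownian.
have G01 k w : 0 <= G k w <= 1.
  rewrite /G; elim: (ts) => [|p l /andP[h0 h1]]; first by rewrite big_nil ler01 lexx.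
  have /andP[? ?] := ramp01 k p.2 (B p.1 w).
  by rewrite big_cons mulr_ge0//= mulr_ile1.
have G_cvg w : G k w @[k --> \oo] --> (\1_(above ts) w : R).
  have -> : \1_(above ts) w = \prod_(p <- ts) ((p.2 < B p.1 w)%R%:R : R).
    rewrite indicE (_ : w \in _ = all (fun p => p.2 < B p.1 w) ts); last first.
      by apply/idP/idP; rewrite in_setE.
    by elim: (ts) => [|p l IH] /=; rewrite ?big_nil// big_cons -IH; case: ltP; rewrite ?mul1r ?mul0r.
  by apply: cvg_prod_seq => p; exact: ramp_cvg.
have intG : \int[P]_w G k w @[k --> \oo] --> fine (P (above ts)).
  rewrite -Rintegral_setE//; apply: bounded_cvg_Rintegral => //.
  exact: aeW.
have intN : \int[N01]_z ramp k a (Num.sqrt (t - s) * z) @[k --> \oo] -->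
    fine (N01 [set z | a < Num.sqrt (t - s) * z]).
  rewrite -(@Rintegral_setE _ RT N01)//; apply: (bounded_cvg_Rintegral (P := N01)) => //.
  - by move=> n; apply: (measurableT_comp (mr _ _)); exact: (@measurable_funM _ _ R).
  - by move=> n w; exact: ramp01.
  - apply: aeW => z; rewrite indicE (_ : z \in _ = (a < Num.sqrt (t - s) * z)).
      exact: ramp_cvg.
    by apply/idP/idP; rewrite in_setE.
have intSG : \int[P]_w (ramp k a (B t w - B s w) * G k w) @[k --> \oo] -->
    fine (P ([set w | a < B t w - B s w] `&` above ts)).
  rewrite -Rintegral_setE; last exact: measurableI.
  apply: bounded_cvg_Rintegral.
  - by move=> k; apply: measurable_funM => //; exact: (measurableT_comp (mr _ _)).
  - by apply: measurable_indic; exact: measurableI.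
  - move=> k w; have /andP[? ?] := G01 k w; have /andP[? ?] := ramp01 k a (B t w - B s w).
    by rewrite mulr_ge0//= mulr_ile1.
  - apply: aeW => w; rewrite indicI /=; apply: cvgM; last exact: G_cvg.
    rewrite indicE (_ : w \in _ = (a < B t w - B s w)); first exact: ramp_cvg.
    by apply/idP/idP; rewrite in_setE.
rewrite -[LHS]fineK; last by apply: fin_num_measure; exact: measurableI.
rewrite -[N01 _]fineK; last exact: fin_num_measure.
rewrite -[P (above ts)]fineK; last exact: fin_num_measure.
rewrite -EFinM; congr EFin; apply: (cvg_unique _ intSG) => //=.
under eq_fun => k.
  rewrite (@brownian_incr_indep_continuous _ _ _ _ br (ramp k a) (ramp k) ts s t) => //; first over.
all: try by move=> *; exact: continuous_ramp.
all: try by move=> *; exact: ramp01.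
exact: cvgM.
Qed.

Let brownian_incr_gt (s t a : R) : 0 <= s -> s <= t -> t <= 1 ->
  P [set w | a < B t w - B s w] = N01 [set z | a < Num.sqrt (t - s) * z].
Proof.
move=> s0 st t1; have := @brownian_incr_indep_above [::] s t a s0 st t1.
rewrite (_ : above [::] = setT); last by apply/seteqP; split.
by rewrite setIT probability_setT mule1; exact.
Qed.

Lemma brownian_incr_law (s t : R) (A : set R) :
  0 <= s -> s <= t -> t <= 1 -> measurable A ->
  P [set w | A (B t w - B s w)] = N01 [set z | A (Num.sqrt (t - s) * z)].
Proof.
move=> s0 st t1 mA.
have mX : measurable_fun setT ((fun w => B t w - B s w) : E -> RT).
  exact: measurable_incrB.
have mz : measurable_fun setT ((fun z => Num.sqrt (t - s) * z) : RT -> RT).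
  exact: (@measurable_funM _ _ R).
rewrite -[LHS]/(pushforward P (fun w => B t w - B s w : RT) A).
rewrite -[RHS]/(pushforward N01 (fun z : RT => Num.sqrt (t - s) * z : RT) A).
apply: measure_unique_ray => //.
  by rewrite -[X in (X < _)%E]/(P setT) probability_setT ltry.
move=> a.
rewrite -[LHS]/(P [set w | (B t w - B s w) \in `]a, +oo[]).
rewrite -[RHS]/(N01 [set z | (Num.sqrt (t - s) * z) \in `]a, +oo[]).
have -> : [set w | (B t w - B s w) \in `]a, +oo[] = [set w | a < B t w - B s w].
  by apply/seteqP; split => w /=; rewrite in_itv/= andbT.
have -> : [set z | (Num.sqrt (t - s) * z) \in `]a, +oo[] = [set z | a < Num.sqrt (t - s) * z].
  by apply/seteqP; split => w /=; rewrite in_itv/= andbT.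
exact: brownian_incr_gt.
Qed.

Lemma brownian_incr_indep (s t : R) : 0 <= s -> s <= t -> t <= 1 ->
  independent_classes P (sigma_rv (fun w => B t w - B s w))
    (sigma_process `[0, s] B).
Proof.
move=> s0 st t1.
(* The whole space is adjoined because the pi-system criterion asks for it and a ray event need not
   be all of it. *)
pose C : set_system E :=
  [set S | S = setT \/ exists a, S = [set w | a < B t w - B s w]].
pose D : set_system E :=
  [set S | exists2 ts, (forall p, p \in ts -> 0 <= p.1 <= s) & S = above ts].
suff CD : independent_classes P <<s C >> <<s D >>.
  move=> X Y HX HY; apply: CD.
    apply: (sigma_rv_sub _ HX) => a; apply: sub_sigma_algebra.
    by right; exists a.
  apply: smallest_sub HY; first exact: smallest_sigma_algebra.
  move=> S [u /=]; rewrite in_itv/= => us; apply: sigma_rv_sub => a.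
  apply: sub_sigma_algebra; exists [:: (u, a)].
    by move=> p; rewrite inE => /eqP ->.
  by apply/seteqP; split => w; rewrite /above/= andbT.
apply: independent_classes_sigma.
- move=> _ [->|[a ->]] //; apply: measurable_gt; exact: measurable_incrB.
- move=> _ _ [->|[a ->]] [->|[b ->]]; rewrite ?setTI ?setIT.
  + by left.
  + by right; exists b.
  + by right; exists a.
  + right; exists (Num.max a b); apply/seteqP.
    by split => w /=; rewrite gt_max => /andP.
- by left.
- by move=> _ [ts _ ->]; exact: measurable_above.
- move=> _ _ [ts hts ->] [us hus ->]; exists (ts ++ us).
    by move=> p; rewrite mem_cat => /orP[/hts|/hus].
  by apply/seteqP; split => w; rewrite /above/= all_cat => /andP.
- by exists [::] => //; apply/seteqP; split.
move=> X _ [->|[a ->]] [ts hts ->].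
  by rewrite setTI probability_setT mul1e.
by rewrite brownian_incr_indep_above// -brownian_incr_gt.
Qed.

End brownian_law.

(** * Time change by W *)

Section normal_scale.
Context {R : realType}.

Lemma normal_pdf_scale (s z : R) : s != 0 ->
  `|s| * normal_pdf 0 s (s * z) = normal_pdf 0 1 z.
Proof.
move=> s0; rewrite (normal_pdfE _ s0) (normal_pdfE _ (oner_neq0 R)) /=.
rewrite /normal_peak /normal_fun mulrA; congr (_ * expR _).
  rewrite expr1n mul1r -mulrnAr sqrtrM ?sqr_ge0// sqrtr_sqr invfM mulrA mulfV ?mul1r//.
  by rewrite normr_eq0.
by rewrite !subr0; field.
Qed.

(** Translates the scaled standard Gaussian, in which the Brownian laws are expressed, into
    [normal_prob] with standard deviation [s]. *)
Lemma normal_prob_scale (s : R) (A : set (measurableTypeR R)) : s != 0 -> measurable A ->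
  normal_prob 0 s A = normal_prob 0 1 [set z | A (s * z)].
Proof.
move=> s0 mA; rewrite /normal_prob integral_mkcond [RHS]integral_mkcond.
have mf : measurable_fun setT ((fun x => (normal_pdf 0 s x)%:E) \_ A).
  apply/(measurable_restrictT _ mA)/measurable_EFinP.
  exact: measurable_funTS (measurable_normal_pdf _ _).
have f0 x : (0 <= ((fun x => (normal_pdf 0 s x)%:E) \_ A) x)%E.
  by rewrite patchE; case: ifP => // _; rewrite lee_fin normal_pdf_ge0.
refine (etrans (ge0_integral_affine 0 s0 mf f0) _).
have mfs : measurable_fun setT (fun x : measurableTypeR R =>
    ((fun x => (normal_pdf 0 s x)%:E) \_ A) (s * x + 0)%R).
  apply: (measurableT_comp mf).
  by apply: (@measurable_funD _ _ R) => //; exact: (@measurable_funM _ _ R).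
rewrite -(ge0_integralZl _ measurableT mfs (fun x _ => f0 _))//.
apply: eq_integral => z _; rewrite !patchE addr0 /=.
have -> : (z \in [set z | A (s * z)]) = (s * z \in A).
  by apply/idP/idP; rewrite !in_setE.
case: ifP => _; last by rewrite mule0.
by rewrite -EFinM normal_pdf_scale.
Qed.

End normal_scale.

Section time_change.
Context {R : realType} d (E : measurableType d) (P : probability E R).
Variable br : gaussian_branching P.
Variable W : R -> R.
Hypothesis W_incr : {homo W : x y / x < y}.
Hypothesis W_cadlag : cadlag_on [set: R] W.
Hypothesis W0 : W 0 = 0.

Let M := W 1.
Let M_gt0 : 0 < M. Proof. by rewrite -W0; exact: W_incr. Qed.
Let tau t := W t / M.

Let W_le x y : x <= y -> W x <= W y.
Proof. by rewrite le_eqVlt => /predU1P[->//|/W_incr/ltW]. Qed.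

Let tau_ge0 t : 0 <= t -> 0 <= tau t.
Proof. by move=> t0; rewrite divr_ge0 ?(ltW M_gt0)// -W0 W_le. Qed.

Let tau_le1 t : t <= 1 -> tau t <= 1.
Proof. by move=> t1; rewrite ler_pdivrMr// mul1r W_le. Qed.

Let tau_lt s t : s < t -> tau s < tau t.
Proof. by move=> /W_incr st; rewrite ltr_pM2r ?invr_gt0. Qed.

(** Dividing by [M] keeps the clock inside [[0, 1]], where the Brownian motion lives; the factor
    [sqrt M] restores the variance [W t - W s]. *)
Definition time_changed_brownian t w := Num.sqrt M * brownian br (tau t) w.
Local Notation Y := time_changed_brownian.

Lemma measurable_time_changed_brownian t : measurable_fun setT (Y t).
Proof. by apply: measurable_funM => //; exact: measurable_brownian. Qed.

Let YB s t : (fun w => Y t w - Y s w) =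
  ( *%R (Num.sqrt M)) \o (fun w => brownian br (tau t) w - brownian br (tau s) w).
Proof. by apply/funext => w /=; rewrite /time_changed_brownian mulrBr. Qed.

Lemma time_changed_brownian_law s t (A : set R) : 0 <= s -> s < t -> t < 1 ->
  measurable A -> P [set w | A (Y t w - Y s w)] =
  normal_prob 0 (Num.sqrt (W t - W s)) A.
Proof.
move=> s0 st t1 mA.
rewrite normal_prob_scale//; last by rewrite sqrtr_eq0 -ltNge subr_gt0 W_incr.
pose A' := [set x | A (Num.sqrt M * x)].
have mA' : measurable A'.
  have m : measurable_fun setT (fun x : R => Num.sqrt M * x) by exact: measurable_funM.
  by rewrite -[X in measurable X]setTI; exact: m.
have := @brownian_incr_law _ _ _ _ br (tau s) (tau t) A' (tau_ge0 s0)
  (ltW (tau_lt st)) (tau_le1 (ltW t1)) mA'.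
rewrite /A' /= => H; transitivity (P [set w | A (Num.sqrt M * (brownian br (tau t) w - brownian br (tau s) w))]).
  by congr (P _); apply/seteqP; split => w; rewrite /time_changed_brownian /= mulrBr.
rewrite H; congr (normal_prob 0 1 _); apply/funext => z /=.
rewrite mulrA -sqrtrM ?(ltW M_gt0)// /tau -mulrBl [M * _]mulrC divfK//.
by rewrite gt_eqF.
Qed.

(** The clock is increasing, so the past of the new process up to [s] lies in the Brownian past up
    to [tau s]; scaling by a constant creates no new events. *)
Lemma time_changed_brownian_indep s t : 0 <= s -> s < t -> t < 1 ->
  independent_classes P (sigma_rv (fun w => Y t w - Y s w))
    (sigma_process `[0, s] Y).
Proof.
move=> s0 st t1 X Z HX HZ.
have mM : measurable_fun setT ( *%R (Num.sqrt M)) by exact: measurable_funM.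
apply: (@brownian_incr_indep _ _ _ _ br (tau s) (tau t) (tau_ge0 s0)
  (ltW (tau_lt st)) (tau_le1 (ltW t1))).
  by rewrite YB in HX; exact: (sigma_rv_comp mM HX).
apply: smallest_sub HZ; first exact: smallest_sigma_algebra.
move=> S [u /=]; rewrite in_itv/= => /andP[u0 us] Su; apply: sub_sigma_algebra.
exists (tau u); first by rewrite /= in_itv/= tau_ge0// ler_pM2r ?invr_gt0// W_le.
exact: (sigma_rv_comp mM Su).
Qed.

Lemma cadlag_time_changed_brownian w : cadlag_on `[0, 1[ (fun t => Y t w).
Proof.
move=> t _.
have cY : continuous (fun y : R => Num.sqrt M * brownian br (y / M) w).
  move=> y; apply: cvgMr.
  apply: (@continuous_comp _ _ _ (fun y : R => y / M) (brownian br ^~ w)).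
    by apply: cvgMl; exact: cvg_id.
  exact: continuous_brownian.
have [Wr /cvg_ex[l Wl]] := @W_cadlag t I.
(* The one-sided limits of [W] on the line survive restriction to [[0, 1[]. Continuity sends the
   right limit [W t] to the value at [t] and the left limit [l] to a finite limit. *)
rewrite !withinET in Wr Wl; split.
  by apply: cvg_within_filter; exact: (cvg_comp _ _ Wr (cY (W t))).
apply/cvg_ex; exists (Num.sqrt M * brownian br (l / M) w).
by apply: cvg_within_filter; exact: (cvg_comp _ _ Wl (cY l)).
Qed.

End time_change.

Unset Implicit Arguments.
Set Strict Implicit.

Theorem proposition1p6p7 (R : realType) (W : R -> R)
  (W_incr : {homo W : x y / x < y})
  (W_cadlag : cadlag_on [set: R] W)
  (W_periodic_incr : forall x, W (x + 1) - W x = W 1 - W 0)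
  (W_cont0 : {for 0, continuous W})
  (W0 : W 0 = 0) :
  exists (d : measure_display) (T : measurableType d) (P : probability T R)
    (B : R -> {RV P >-> R}), W_Brownian_motion W B.
Proof.
have [d [E [P [br]]]] := @gaussian_branching_exists R.
pose B t : {RV P >-> R} := HB.pack (time_changed_brownian br W t)
  (isMeasurableFun.Build _ _ _ _ _ (measurable_time_changed_brownian br W t)).
exists d, E, P, B; split.
- by apply: aeW => w; rewrite /= /time_changed_brownian W0 mul0r brownian0 mulr0.
- by move=> s t s0 st t1; exact: (time_changed_brownian_indep W_incr W0 s0 st t1).
- by move=> s t s0 st t1 A mA; exact: (time_changed_brownian_law br W_incr W0 s0 st t1 mA).
- by move=> w; exact: cadlag_time_changed_brownian.
Qed.
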